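(* Let $d\ge 1$ and let $\mathcal{P}\in\mathscr{P}_d$ be a pencil of plane curves of degree $d$. If $\mathcal{P}$ is semistable, then $lct_p(\mathbb{P}^2,C_f)\geq\frac{3}{2d}$ for any curve $C_f$ in $\mathcal{P}$ and any base point $p$ of $\mathcal{P}$. If $\mathcal{P}$ is stable, then $lct_p(\mathbb{P}^2,C_f)>\frac{3}{2d}$ for any curve $C_f$ in $\mathcal{P}$ and any base point $p$ of $\mathcal{P}$.
   Context: The ground field is $\mathbb{C}$. Let $S_d$ be the vector space of homogeneous forms of degree $d$ in three variables. A plane curve of degree $d$ is $C_f=\{f=0\}\subset\mathbb{P}^2$ with $0\ne f\in S_d$ (taken up to scalar), regarded as an effective divisor (possibly non-reduced or reducible). A pencil of plane curves of degree $d$ is a two-dimensional subspace of $S_d$; its members (the curves in it) are the $C_f$ with $f$ a nonzero element of that subspace, and a base point is a point of $\mathbb{P}^2$ lying on all members. The space of all such pencils is $\mathscr{P}_d=Gr(2,S_d)$, embedded by Plücker coordinates in $\mathbb{P}(\Lambda^2 S_d)$. Stability: $SL(3)$ acts on $S_d$ by linear changes of coordinates, hence on $\Lambda^2S_d$ and on $\mathscr{P}_d\subset\mathbb{P}(\Lambda^2S_d)$. A point of a projective variety $X\subset\mathbb{P}(W)$ with linear $SL(3)$-action is semistable if, for a nonzero lift $\tilde{x}\in W$, $0\notin\overline{SL(3)\cdot\tilde{x}}$; it is stable if the orbit $SL(3)\cdot\tilde{x}$ is closed in $W$ and the stabilizer of $\tilde{x}$ is finite. $lct_p(X,\Delta)$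 is the supremum of all $t$ such that $(X,t\Delta)$ is log canonical in an open neighborhood of the closed point $p\in X$. *)

(* Defs.v *)
From HB Require Import structures.
From mathcomp Require Import all_boot all_order all_algebra.
From mathcomp Require Import fraction generic_quotient mpoly complex ring.
From mathcomp Require Import boolp classical_sets cardinality.
From mathcomp Require Import reals constructive_ereal ereal.

Set Implicit Arguments.
Unset Strict Implicit.
Unset Printing Implicit Defensive.

Import Order.TTheory GRing.Theory Num.Theory VectorInternalTheory.
Local Open Scope classical_set_scope.
Local Open Scope ring_scope.

(** * Forms, pencils, and the action of SL(3) *)

Notation ternary_form k d := (dhomog 3 k d).

(* (A . f)(X) = f(X A), for row vectors X. This is a left action. *)
Definition linear_subst (k : fieldType) (A : 'M[k]_3) : 3.-tuple {mpoly k[3]} :=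
  [tuple \sum_(j < 3) A j i *: 'X_j | i < 3].

Lemma linear_subst_homog (k : fieldType) (d : nat) (A : 'M[k]_3)
    (f : ternary_form k d) :
  (f : {mpoly k[3]}) \mPo linear_subst A \is d.-homog.
Proof.
rewrite comp_mpolyE big_seq; apply: rpred_sum => m fm; apply: rpredZ.
have -> : d = mdeg m.
  by apply/esym; move/dhomogP: (dhomog_is_dhomog f); apply.
rewrite mdegE.
apply: (big_ind2 (fun (p : {mpoly k[3]}) e => p \is e.-homog)).
- exact: dhomog1.
- by move=> p e q e' hp hq; apply: dhomogM.
- move=> i _; rewrite tnth_mktuple -[X in X.-homog]mul1n.
  by apply: dhomogMn; apply: rpred_sum => j _; apply: rpredZ; rewrite dhomogX /= mdeg1.
Qed.

Definition form_act (k : fieldType) (d : nat) (A : 'M[k]_3)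
    (f : ternary_form k d) : ternary_form k d :=
  DHomog (linear_subst_homog A f).

Definition is_pencil (k : fieldType) (d : nat)
    (P : {vspace ternary_form k d}) : Prop := \dim P = 2%N.

(* The second exterior power of S_d is realised as the space of alternating
   tensors, i.e. of alternating matrices in the coordinates [v2r] of S_d; the
   entries of [wedge f g] are the Plücker coordinates of <f, g>. *)
Notation tensor2 k d :=
  'M[k]_(dim (ternary_form k d), dim (ternary_form k d)).

Definition wedge (k : fieldType) (d : nat) (f g : ternary_form k d) :
    tensor2 k d :=
  (v2r f)^T *m v2r g - (v2r g)^T *m v2r f.

Definition form_act_mx (k : fieldType) (d : nat) (A : 'M[k]_3) : tensor2 k d :=
  lin1_mx (fun r => v2r (form_act A (r2v r : ternary_form k d))).

Lemma form_act_mxE (k : fieldType) (d : nat) (A : 'M[k]_3)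
    (f : ternary_form k d) :
  v2r (form_act A f) = v2r f *m form_act_mx d A.
Proof.
have L : linear (fun r => v2r (form_act A (r2v r : ternary_form k d))).
  move=> c r s; pose h z := form_act A (r2v z : ternary_form k d).
  have -> : form_act A (r2v (c *: r + s) : ternary_form k d) = c *: h r + h s.
    by apply: val_inj => /=; rewrite !linearP.
  by rewrite linearP.
pose LL := GRing.isLinear.Build _ _ _ _ _ L.
pose F : {linear _ -> _} :=
  HB.pack (fun r => v2r (form_act A (r2v r : ternary_form k d))) LL.
have := mul_rV_lin1 F (v2r f); rewrite /F /= v2rK => <-; exact: erefl.
Qed.

Definition tensor_act (k : fieldType) (d : nat) (A : 'M[k]_3)
    (w : tensor2 k d) : tensor2 k d :=
  (form_act_mx d A)^T *m w *m form_act_mx d A.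

Lemma tensor_act_wedge (k : fieldType) (d : nat) (A : 'M[k]_3)
    (f g : ternary_form k d) :
  tensor_act A (wedge f g) = wedge (form_act A f) (form_act A g).
Proof.
rewrite /wedge !form_act_mxE /tensor_act !trmx_mul mulmxBr mulmxBl.
by rewrite !mulmxA.
Qed.

Definition SL3 (k : fieldType) : set 'M[k]_3 := [set A | \det A = 1].

Definition SL3_orbit (k : fieldType) (d : nat) (w : tensor2 k d) :
    set (tensor2 k d) :=
  [set tensor_act A w | A in @SL3 k].

Definition SL3_stabilizer (k : fieldType) (d : nat) (w : tensor2 k d) :
    set 'M[k]_3 :=
  [set A | SL3 A /\ tensor_act A w = w].

Definition zariski_closure (k : fieldType) (m n : nat) (S : set 'M[k]_(m, n)) :
    set 'M[k]_(m, n) :=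
  [set w | forall F : {mpoly k[m * n]},
     (forall s, S s -> F.@[mxvec s ord0] = 0) -> F.@[mxvec w ord0] = 0].

Definition plucker_lift (k : fieldType) (d : nat)
    (P : {vspace ternary_form k d}) (w : tensor2 k d) : Prop :=
  exists f g : ternary_form k d, P = <<[:: f; g]>>%VS /\ w = wedge f g.

Definition semistable (k : fieldType) (d : nat)
    (P : {vspace ternary_form k d}) : Prop :=
  exists w, plucker_lift P w /\ ~ zariski_closure (SL3_orbit w) 0.

Definition stable (k : fieldType) (d : nat)
    (P : {vspace ternary_form k d}) : Prop :=
  exists w, [/\ plucker_lift P w,
    zariski_closure (SL3_orbit w) `<=` SL3_orbit w &
    finite_set (SL3_stabilizer w)].

(* [p] is a nonzero vector of homogeneous coordinates. *)
Definition base_point (k : fieldType) (d : nat)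
    (P : {vspace ternary_form k d}) (p : 'rV[k]_3) : Prop :=
  p != 0 /\
  forall f : ternary_form k d, f \in P -> (f : {mpoly k[3]}).@[p ord0] = 0.

(** * Divisors over the projective plane *)

(* The function field k(x, y), where x and y are the affine coordinates on the
   chart where the third homogeneous coordinate is 1. *)
Notation plane_field k := {fraction {mpoly k[2]}}.

Definition ff_const (k : fieldType) (c : k) : plane_field k :=
  tofrac (c%:MP : {mpoly k[2]}).
Definition ff_x (k : fieldType) : plane_field k :=
  tofrac ('X_ord0 : {mpoly k[2]}).
Definition ff_y (k : fieldType) : plane_field k :=
  tofrac ('X_ord_max : {mpoly k[2]}).

Definition ff_eval (k : fieldType) (n : nat) (a : 'I_n -> plane_field k)
    (F : {mpoly k[n]}) : plane_field k :=
  mmap (@ff_const k) a F.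

Definition ff_deriv (k : fieldType) (i : 'I_2) (z : plane_field k) :
    plane_field k :=
  let n := (frac (repr z)).1 in
  let q := (frac (repr z)).2 in
  tofrac (n^`M(i) * q - n * q^`M(i)) / tofrac (q ^+ 2).

Lemma ff_deriv_tofrac (k : fieldType) (i : 'I_2) (p : {mpoly k[2]}) :
  ff_deriv i (tofrac p) = tofrac (p^`M(i)).
Proof.
rewrite /ff_deriv; set r := repr _.
have hr : \pi_({fraction {mpoly k[2]}})%qT r = tofrac p by rewrite reprK.
have q0 := denom_ratioP r.
have e : (frac r).1 = (frac r).2 * p.
  move: hr; unlock FracField.tofrac => /eqmodP /eqP /=.
  by rewrite !numden_Ratio ?oner_eq0 // mulr1.
have q20 : tofrac ((frac r).2 ^+ 2) != 0 by rewrite tofrac_eq0 expf_neq0.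
apply: (mulIf q20); rewrite divfK // -tofracM e mderivM.
by congr tofrac; ring.
Qed.

(* du /\ dw = (jacobian u w) dx /\ dy *)
Definition jacobian (k : fieldType) (u w : plane_field k) : plane_field k :=
  ff_deriv ord0 u * ff_deriv ord_max w - ff_deriv ord_max u * ff_deriv ord0 w.

(* The value of [v] at 0 is irrelevant. *)
Record discrete_valuation (k : fieldType) (v : plane_field k -> int) : Prop := {
  valuation_surj : exists u, u != 0 /\ v u = 1;
  valuationM : forall a b, a != 0 -> b != 0 -> v (a * b) = v a + v b;
  valuationD : forall a b, a != 0 -> b != 0 -> a + b != 0 ->
    Num.min (v a) (v b) <= v (a + b);
  valuation_const : forall c : k, c != 0 -> v (ff_const c) = 0
}.

Definition in_valuation_ring (k : fieldType) (v : plane_field k -> int)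
    (z : plane_field k) : Prop :=
  z = 0 \/ 0 <= v z.

(* A prime divisor E on a variety Y with a birational map to the plane, seen
   through its order of vanishing v. The elements a_i generate the coordinate
   ring of an affine chart of Y meeting E, and the last condition says that the
   valuation ring of v is the local ring of that chart at the generic point
   of E. Both curves on the plane and exceptional divisors are covered. *)
Definition divisor_over_plane (k : fieldType) (v : plane_field k -> int) :
    Prop :=
  discrete_valuation v /\
  exists (n : nat) (a : 'I_n -> plane_field k),
    (forall i, in_valuation_ring v (a i)) /\
    forall z, in_valuation_ring v z ->
      exists F G : {mpoly k[n]},
        [/\ ff_eval a G != 0, v (ff_eval a G) = 0 &
            z = ff_eval a F / ff_eval a G].

(* Smallest order along E of the homogeneous coordinates (x : y : 1). *)
Definition min_coord_order (k : fieldType) (v : plane_field k -> int) : int :=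
  Num.min (v (ff_x k)) (Num.min (v (ff_y k)) 0).

Definition dehomogenize (k : fieldType) (f : {mpoly k[3]}) : plane_field k :=
  ff_eval (fun i : 'I_3 => [:: ff_x k; ff_y k; 1]`_i) f.

(* Multiplicity along E of the pullback of the curve f = 0: locally at the
   centre of E an equation of the curve is f / l ^ d, with l a homogeneous
   coordinate of smallest order. *)
Definition curve_order (k : fieldType) (d : nat) (v : plane_field k -> int)
    (f : ternary_form k d) : int :=
  v (dehomogenize f) - d%:Z * min_coord_order v.

(* A uniformizer u at the generic point of E and a function w whose restriction
   to E is transcendental over k: in characteristic 0, du /\ dw then generates
   the 2-forms at the generic point of E. *)
Definition coordinates_along (k : fieldType) (v : plane_field k -> int)
    (u w : plane_field k) : Prop :=
  [/\ u != 0, v u = 1 &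
      forall q : {poly k}, q != 0 ->
        (map_poly (@ff_const k) q).[w] != 0 /\
        v (map_poly (@ff_const k) q).[w] = 0].

(* The coefficient of E in K_Y - pi^* K, with K_Y and K the divisors of the
   2-form dx /\ dy on Y and on the plane. The former has order
   - v (jacobian u w) along E, and K is -3 times the line at infinity, whose
   pullback has order - min_coord_order v along E. *)
Definition discrepancy (k : fieldType) (v : plane_field k -> int)
    (u w : plane_field k) : int :=
  - v (jacobian u w) - 3 * min_coord_order v.

(* [curve_order v h = 0] says that the centre of E on the plane is not contained
   in h = 0, i.e. that E is a divisor over the open set h <> 0. *)
Definition log_canonical_on (R : realType) (k : fieldType) (e d : nat)
    (h : ternary_form k e) (f : ternary_form k d) (t : R) : Prop :=
  forall v : plane_field k -> int, divisor_over_plane v ->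
    curve_order v h = 0 ->
    forall u w, coordinates_along v u w ->
      -1 <= (discrepancy v u w)%:~R - t * (curve_order v f)%:~R.

(* It suffices to consider the principal open neighborhoods h <> 0 of p. *)
Definition log_canonical_near (R : realType) (k : fieldType) (d : nat)
    (p : 'rV[k]_3) (f : ternary_form k d) (t : R) : Prop :=
  exists (e : nat) (h : ternary_form k e),
    (h : {mpoly k[3]}).@[p ord0] != 0 /\ log_canonical_on h f t.

Definition lct (R : realType) (d : nat) (p : 'rV[R[i]]_3)
    (f : ternary_form R[i] d) : \bar R :=
  ereal_sup [set t%:E | t in [set t : R | log_canonical_near p f t]].

(* Main.v *)
Require Import Defs.
From HB Require Import structures.
From mathcomp Require Import all_boot all_order all_algebra perm.
From mathcomp Require Import fraction generic_quotient mpoly complex ring lra zify.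
From mathcomp Require Import boolp classical_sets cardinality.
From mathcomp Require Import reals constructive_ereal ereal.

Set Implicit Arguments.
Unset Strict Implicit.
Unset Printing Implicit Defensive.

Import Order.TTheory GRing.Theory Num.Theory VectorInternalTheory.
Local Open Scope ring_scope.

(** The number 3/(2d) is produced by lines.  Stability bounds the multiplicity of
    a line in a member of the pencil, and that multiplicity bounds the log
    canonical threshold at every point of the plane.

    Stability and lines.  Suppose that a member of the pencil contains a line [r]
    times.  Let the one-parameter subgroup of SL(3) with weight 2 on the equation
    of the line and weight -1 on two further coordinates act on the Plücker lift
    of the pencil.  The member has weights at least [3r - d] and every form has
    weights at least [-d], so the lift has weights at least [3r - 2d].  If
    [3r > 2d], the limit of the lift is 0 and the pencil is not semistable
    ([semistable_line]).  If [3r = 2d], the limit is fixed by the subgroup; if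
    the orbit were closed it would contain the limit, and the stabilizer of the
    lift would be infinite ([stable_line]).

    Lines and thresholds.  For a divisor E over the plane with log discrepancy A
    and a curve f of degree d, some line, of multiplicity [r] in f, satisfies
    [ord_E f <= A * max (d/2, r)] ([curve_order_bound]).  So the pair with
    coefficient t is log canonical as soon as [t * max (d, 2r) <= 2] for all
    lines ([lct_ge]).  In the semistable case [3r <= 2d] allows t = 3/(2d).  In
    the stable case [3r < 2d] gives [6r <= 4d - 2], which allows t = 6/(4d - 1),
    a number larger than 3/(2d).

    The bound on orders.  No resolution is computed: all that is used about E is
    that for functions g and h the form [dg/g /\ dh/h] has at most a simple pole
    along E ([jac_order]).  It follows that in affine coordinates x and y that
    are regular along E, differentiating a polynomial with respect to x lowers
    its order by at most [A - ord_E y], and symmetrically for y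
    ([log_coordinates]).  Differentiating until a chosen monomial becomes a
    constant bounds the order by that monomial ([dval_le_monomial]).  Choose the
    affine coordinates so that first [b = ord_E y] and then [a = ord_E x] is as
    large as possible.  If [0 < a < b], the centre of E is a point with the
    tangent direction [y = 0]; the multiplicity of the curve gives one bound, the
    strict transform after one blow-up gives another, and together they suffice
    ([dval_le_point]).  If [0 < a = b], the order is [a] times a multiplicity
    ([dval_le_ordinary]).  If [0 = a < b], the centre is the line [y = 0]
    ([dval_le_line]).  If [a = b = 0], the centre is a curve of degree at least
    2, whose multiplicity in f is at most d/2 ([dval_le_curve]).

    The simple pole.  Let u be a uniformizer of E and w a function whose residue
    is transcendental.  Expressing all derivations through the partial
    derivatives with respect to u and w, the claim reduces to these preserving
    the valuation ring ([derivation_regular]).  Since the valuation ring is a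
    localisation of a finitely generated algebra, a derivation creates poles of
    bounded order there; a pole would induce a nonzero derivation of the residue
    field over k(w), which is impossible because in characteristic 0 that field
    is separably algebraic over k(w).  Algebraicity comes from the dependence of
    any three rational functions of two variables ([algebraic_dependence]). *)

(** * Polynomial evaluation *)

(** Iterated, this evaluates polynomials in several variables, which are nested
    univariate polynomials with the last variable outermost. *)
Definition evalp (A : nzRingType) (B : comNzRingType) (phi : {rmorphism A -> B})
    (x : B) (p : {poly A}) : B := (map_poly phi p).[x].

HB.instance Definition _ (A : nzRingType) (B : comNzRingType)
    (phi : {rmorphism A -> B}) (x : B) :=
  GRing.RMorphism.copy (evalp phi x)
    (horner_morph (fun c => mulrC x (phi c) : GRing.comm x (phi c))).

Section EvalTheory.
Variables (A : nzRingType) (B : comNzRingType) (phi : {rmorphism A -> B}) (x : B).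

Lemma evalpC c : evalp phi x c%:P = phi c.
Proof. by rewrite /evalp map_polyC hornerC. Qed.

Lemma evalpX : evalp phi x 'X = x.
Proof. by rewrite /evalp map_polyX hornerX. Qed.

Lemma evalpXn n : evalp phi x 'X^n = x ^+ n.
Proof. by rewrite rmorphXn /= evalpX. Qed.

Lemma evalpE n (p : {poly A}) : (size p <= n)%N ->
  evalp phi x p = \sum_(i < n) phi p`_i * x ^+ i.
Proof.
move=> sp; rewrite /evalp (@horner_coef_wide _ n).
  by apply: eq_bigr => i _; rewrite coef_map.
exact: leq_trans (size_poly _ _) sp.
Qed.

Lemma evalp_poly n E :
  evalp phi x (\poly_(i < n) E i : {poly A}) = \sum_(i < n) phi (E i) * x ^+ i.
Proof.
rewrite (@evalpE n) ?size_poly //; apply: eq_bigr => i _.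
by rewrite coef_poly ltn_ord.
Qed.
End EvalTheory.

Section Evaluation.
Variables (k K : fieldType) (cst : {rmorphism k -> K}).

Definition eval1 (x : K) := evalp cst x.
HB.instance Definition _ x := GRing.RMorphism.on (eval1 x).
Definition eval2 (x y : K) := evalp (eval1 x) y.
HB.instance Definition _ x y := GRing.RMorphism.on (eval2 x y).
Definition eval3 (x y z : K) := evalp (eval2 x y) z.
HB.instance Definition _ x y z := GRing.RMorphism.on (eval3 x y z).
End Evaluation.

(** * Derivations *)

Section Derivations.
Variables (k K : fieldType) (cst : {rmorphism k -> K}).
Implicit Types (a b z : K).

(** Linearity over the constants [cst k] follows from the last condition. *)
Record derivation (D : K -> K) : Prop := {
  derivationD : forall a b, D (a + b) = D a + D b;
  derivationM : forall a b, D (a * b) = D a * b + a * D b;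
  derivation_const : forall c, D (cst c) = 0
}.

Section DerivationTheory.
Variables (D : K -> K) (derD : derivation D).

Lemma derivation0 : D 0 = 0.
Proof. by have := derivation_const derD 0; rewrite rmorph0. Qed.

Lemma derivation1 : D 1 = 0.
Proof. by have := derivation_const derD 1; rewrite rmorph1. Qed.

Lemma derivation_sum (I : Type) (s : seq I) (F : I -> K) :
  D (\sum_(i <- s) F i) = \sum_(i <- s) D (F i).
Proof.
elim: s => [|i s IH]; first by rewrite !big_nil derivation0.
by rewrite !big_cons (derivationD derD) IH.
Qed.

Lemma derivationX a n : D (a ^+ n) = a ^+ n.-1 * D a *+ n.
Proof.
elim: n => [|n IH]; first by rewrite derivation1 mulr0n.
case: n IH => [|n] IH /=; first by rewrite mul1r.
rewrite exprS (derivationM derD) IH /= mulrnAr mulrA -exprS mulrC addrC.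
by rewrite -mulrSr.
Qed.

Lemma derivationV a : a != 0 -> D a^-1 = - D a / a ^+ 2.
Proof.
move=> a0; have E : D a / a + a * D a^-1 = 0 by rewrite -(derivationM derD) divff ?derivation1.
have -> : D a^-1 = a^-1 * (D a / a + a * D a^-1) - D a / a ^+ 2 by field.
by rewrite E mulr0 sub0r mulNr.
Qed.

Lemma derivation_div a b : b != 0 -> D (a / b) = (D a * b - a * D b) / b ^+ 2.
Proof. by move=> b0; rewrite (derivationM derD) derivationV //; field. Qed.

Lemma derivation_scale c : derivation (fun z => c * D z).
Proof.
split=> [a b|a b|e]; first by rewrite (derivationD derD) mulrDr.
- by rewrite (derivationM derD); ring.
- by rewrite (derivation_const derD) mulr0.
Qed.

(** Chain rule for a polynomial whose coefficients need not be constant: the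
    two terms differentiate the variable and the coefficients. *)
Lemma derivation_evalp (A : nzRingType) (phi : {rmorphism A -> K}) (P : {poly A}) z :
  D (evalp phi z P) = evalp phi z P^`() * D z +
     \sum_(i < size P) D (phi P`_i) * z ^+ i.
Proof.
pose n := size P.
rewrite (@evalpE _ _ _ _ n P) // derivation_sum.
rewrite (@evalpE _ _ _ _ n.-1); last first.
  case: (eqVneq P 0) => [->|P0]; first by rewrite deriv0 size_poly0.
  by rewrite -ltnS prednK ?lt_size_deriv // size_poly_gt0.
under eq_bigr do rewrite (derivationM derD) derivationX.
rewrite big_split /= addrC; congr (_ + _).
rewrite mulr_suml; case: n => [|n]; first by rewrite !big_ord0.
rewrite big_ord_recl /= mulr0n mulr0 add0r; apply: eq_bigr => i _.
by rewrite coef_deriv rmorphMn /= /bump add1n mulrnAr !mulrnAl mulrA.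
Qed.

Lemma derivation_evalp_const (A : nzRingType) (phi : {rmorphism A -> K})
    (P : {poly A}) z :
  (forall c, D (phi c) = 0) -> D (evalp phi z P) = evalp phi z P^`() * D z.
Proof.
move=> D0; rewrite derivation_evalp big1 ?addr0 // => i _.
by rewrite D0 mul0r.
Qed.

End DerivationTheory.

Section Jacobian.
Variables (D0 D1 : K -> K) (der0 : derivation D0) (der1 : derivation D1).

(** The coefficient of [da /\ db] for coordinates with partial derivatives
    [D0] and [D1]. *)
Definition jac a b := D0 a * D1 b - D1 a * D0 b.

Lemma jac_derivationl w : derivation (fun z => jac z w).
Proof.
split=> [a b|a b|c]; rewrite /jac.
- by rewrite (derivationD der0) (derivationD der1); ring.
- by rewrite (derivationM der0) (derivationM der1); ring.
- by rewrite (derivation_const der0) (derivation_const der1); ring.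
Qed.

Lemma jacC a b : jac a b = - jac b a.
Proof. by rewrite /jac; ring. Qed.

Lemma jac_self a : jac a a = 0.
Proof. by rewrite /jac; ring. Qed.

Lemma jac_derivationr u : derivation (jac u).
Proof.
have D := jac_derivationl u.
split=> [a b|a b|c]; rewrite !(jacC u).
- by rewrite (derivationD D) opprD.
- by rewrite (derivationM D); ring.
- by rewrite (derivation_const D) oppr0.
Qed.

(** The Plücker relation for the four differentials. *)
Lemma jac_exchange a b u w :
  jac a b * jac u w = jac a w * jac u b - jac b w * jac u a.
Proof. by rewrite /jac; ring. Qed.

End Jacobian.
End Derivations.

(** * Valuations trivial on the constants *)

Section Valuations.
Variables (k K : fieldType) (cst : {rmorphism k -> K}) (v : K -> int).

(** Surjectivity is left to the choice of a uniformizer, where one is needed. *)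
Record dvaluation : Prop := {
  dvalM : forall a b, a != 0 -> b != 0 -> v (a * b) = v a + v b;
  dvalD : forall a b, a != 0 -> b != 0 -> a + b != 0 ->
    Num.min (v a) (v b) <= v (a + b);
  dval_const : forall c : k, c != 0 -> v (cst c) = 0
}.

(** Order at least [n]; the value of [v] at 0 carries no information, hence the
    separate case. *)
Definition vge (n : int) (z : K) : Prop := z = 0 \/ n <= v z.

(** The residue of [w] is transcendental over the constants. *)
Definition residue_transcendental (w : K) : Prop :=
  forall q : {poly k}, q != 0 -> eval1 cst w q != 0 /\ v (eval1 cst w q) = 0.

(** The valuation ring is a localisation of a finitely generated algebra. *)
Definition finite_type : Prop :=
  exists (n : nat) (a : 'I_n -> K),
    (forall i, vge 0 (a i)) /\
    forall z, vge 0 z -> exists F G : {mpoly k[n]},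
      [/\ mmap cst a G != 0, v (mmap cst a G) = 0 & z = mmap cst a F / mmap cst a G].

Hypothesis val_v : dvaluation.

Lemma dval1 : v 1 = 0.
Proof. by rewrite -(rmorph1 cst) (dval_const val_v) ?oner_neq0. Qed.

Lemma dvalV a : a != 0 -> v a^-1 = - v a.
Proof.
move=> a0; apply/eqP; rewrite -addr_eq0 addrC -(dvalM val_v) ?invr_eq0 //.
by rewrite divff // dval1.
Qed.

Lemma dvalN a : v (- a) = v a.
Proof.
case: (eqVneq a 0) => [->|a0]; first by rewrite oppr0.
rewrite -mulN1r (dvalM val_v) ?oppr_eq0 ?oner_eq0 //.
rewrite -(rmorph1 cst) -rmorphN (dval_const val_v) ?oppr_eq0 ?oner_eq0 //.
by rewrite add0r.
Qed.

Lemma dvalX a n : a != 0 -> v (a ^+ n) = v a *+ n.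
Proof.
move=> a0; elim: n => [|n IH]; first by rewrite dval1.
by rewrite exprS (dvalM val_v) ?expf_neq0 // IH mulrS.
Qed.

Lemma vge_nz n z : z != 0 -> vge n z -> n <= v z.
Proof. by move=> z0 [Z|//]; rewrite Z eqxx in z0. Qed.

Lemma vge_refl z : vge (v z) z. Proof. by right. Qed.

Lemma vgeW m n z : m <= n -> vge n z -> vge m z.
Proof. by move=> mn [->|nz]; [left|right; apply: le_trans nz]. Qed.

Lemma vgeD n a b : vge n a -> vge n b -> vge n (a + b).
Proof.
move=> [->|na]; first by rewrite add0r.
move=> [->|nb]; first by rewrite addr0; right.
case: (eqVneq (a + b) 0) => [|ab0]; [by left|right].
case: (eqVneq a 0) => [->|a0]; first by rewrite add0r.
case: (eqVneq b 0) => [->|b0]; first by rewrite addr0.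
by apply: le_trans (dvalD val_v a0 b0 ab0); rewrite le_min na.
Qed.

Lemma vgeN n a : vge n a -> vge n (- a).
Proof. by move=> [->|na]; [left; rewrite oppr0|right; rewrite dvalN]. Qed.

Lemma vgeB n a b : vge n a -> vge n b -> vge n (a - b).
Proof. by move=> na nb; apply: vgeD => //; apply: vgeN. Qed.

Lemma vgeM m n a b : vge m a -> vge n b -> vge (m + n) (a * b).
Proof.
move=> [->|ma]; first by rewrite mul0r; left.
move=> [->|nb]; first by rewrite mulr0; left.
case: (eqVneq a 0) => [->|a0]; first by rewrite mul0r; left.
case: (eqVneq b 0) => [->|b0]; first by rewrite mulr0; left.
by right; rewrite (dvalM val_v) // lerD.
Qed.

Lemma vge_cst c : vge 0 (cst c).
Proof.
by case: (eqVneq c 0) => [->|c0]; [left; rewrite rmorph0|right; rewrite (dval_const val_v)].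
Qed.

Lemma vge1 : vge 0 1. Proof. by right; rewrite dval1. Qed.

Lemma vgeX a n : vge 0 a -> vge 0 (a ^+ n).
Proof.
move=> a0; elim: n => [|n IH]; first exact: vge1.
by rewrite exprS -(addr0 0); apply: vgeM.
Qed.

Lemma vge_sum n (I : Type) (r : seq I) (F : I -> K) :
  (forall i, vge n (F i)) -> vge n (\sum_(i <- r) F i).
Proof. by move=> nF; elim/big_rec: _ => [|i x _]; [left|apply: vgeD]. Qed.

Lemma vge_mulr n a b : b != 0 -> vge (n + v b) (a * b) -> vge n a.
Proof.
move=> b0 [/eqP|]; first by rewrite mulf_eq0 (negPf b0) orbF => /eqP->; left.
case: (eqVneq a 0) => [->|a0]; first by left.
by rewrite (dvalM val_v) // lerD2r; right.
Qed.

Lemma vge_evalp (A : nzRingType) (phi : {rmorphism A -> K}) x (P : {poly A}) :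
  (forall c, vge 0 (phi c)) -> vge 0 x -> vge 0 (evalp phi x P).
Proof.
move=> phi0 x0; rewrite (evalpE _ _ (leqnn _)); apply: vge_sum => i.
by rewrite -(addr0 0); apply: vgeM; [apply: phi0 | apply: vgeX].
Qed.

Lemma vge_eval1 x p : vge 0 x -> vge 0 (eval1 cst x p).
Proof. by move=> x0; apply: vge_evalp x0; apply: vge_cst. Qed.

Lemma vge_eval2 x y p : vge 0 x -> vge 0 y -> vge 0 (eval2 cst x y p).
Proof. by move=> x0 y0; apply: vge_evalp y0 => c; apply: vge_eval1. Qed.

(** The dominant term decides. *)
Lemma dval_dominant a b : a != 0 -> vge (v a + 1) b -> a + b != 0 /\ v (a + b) = v a.
Proof.
move=> a0 ab.
have ab0 : a + b != 0.
  apply/eqP => /eqP; rewrite addr_eq0 => /eqP E.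
  have b0 : b != 0 by rewrite -oppr_eq0 -E.
  by have := vge_nz b0 ab; rewrite E dvalN; lia.
split=> //; apply/eqP; rewrite eq_le; apply/andP; split.
  rewrite leNgt; apply/negP => lt_a.
  have : vge (v a + 1) (a + b - b) by apply: vgeB => //; right; lia.
  by rewrite addrK => /(vge_nz a0); lia.
by apply: (vge_nz ab0); apply: vgeD (vge_refl _) _; apply: vgeW ab; lia.
Qed.

Lemma dval_unit_add a b : a != 0 -> v a = 0 -> vge 1 b -> a + b != 0 /\ v (a + b) = 0.
Proof. by move=> a0 va b1; rewrite -va; apply: dval_dominant; rewrite ?va. Qed.

End Valuations.

(** * Derivations preserve the valuation ring *)

Lemma poly_lowest_term (A : idomainType) (p : {poly A}) : p != 0 ->
  exists n q, p = q * 'X^n /\ q`_0 != 0.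
Proof.
move=> p0; have [n [q nq pE]] := multiplicity_XsubC p 0.
exists n, q; rewrite -[in 'X^n](subr0 'X) -polyC0; split=> //.
by move: nq; rewrite p0 /= /root horner_coef0.
Qed.

Lemma poly_coef0_drop (A : nzRingType) (p : {poly A}) :
  p = (p`_0)%:P + drop_poly 1 p * 'X.
Proof.
apply/polyP => -[|i]; rewrite coefD coefC coefMX /= ?addr0 // add0r.
by rewrite coef_drop_poly addn1.
Qed.

Lemma deriv_neq0 (A : idomainType) (p : {poly A}) :
  [pchar A] =i pred0 -> (1 < size p)%N -> p^`() != 0.
Proof.
move=> /pcharf0P ch0 sp; apply/eqP => /(congr1 (fun q : {poly A} => q`_(size p).-2)).
rewrite coef0 coef_deriv.
have -> : (size p).-2.+1 = (size p).-1 by case: (size p) sp => [|[]].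
move/eqP; rewrite -mulr_natr mulf_eq0 ch0 -lead_coefE lead_coef_eq0.
by case: eqP sp => [->|_]; [rewrite size_poly0|case: (size p) => [|[]]].
Qed.

Lemma pchar_poly0 (A : idomainType) : [pchar A] =i pred0 -> [pchar {poly A}] =i pred0.
Proof.
move=> /pcharf0P ch0; apply/pcharf0P => n.
have -> : n%:R = (n%:R)%:P :> {poly A} by rewrite rmorph_nat.
by rewrite polyC_eq0 ch0.
Qed.

Section RegularDerivations.
Variables (k K : fieldType) (cst : {rmorphism k -> K}) (v : K -> int).
Hypothesis val_v : dvaluation cst v.
Hypothesis pchar0 : [pchar k] =i pred0.
Hypothesis ft_v : finite_type cst v.
Hypothesis dep : forall z0 z1 z2 : K,
  exists2 P : {poly {poly {poly k}}}, P != 0 & eval3 cst z0 z1 z2 P = 0.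
Variables u w : K.
Hypotheses (u0 : u != 0) (vu : v u = 1) (res_w : residue_transcendental cst v w).

Lemma vge_residue_transcendental : vge v 0 w.
Proof.
have [_] := res_w (negbT (polyX_eq0 k)); rewrite /eval1 evalpX => vw.
by right; rewrite vw.
Qed.

Let w_ge0 := vge_residue_transcendental.

(** [u] and [w] are algebraically independent, because the lowest power of [u]
    that occurs in [G] has a unit as its coefficient. *)
Lemma eval2_uniformizer_neq0 (G : {poly {poly k}}) : G != 0 -> eval2 cst w u G != 0.
Proof.
move=> /poly_lowest_term [n [H [-> H0]]].
rewrite rmorphM /= rmorphXn /= /eval2 evalpX mulf_neq0 ?expf_neq0 //.
rewrite (poly_coef0_drop H) rmorphD rmorphM /= evalpC evalpX.
have [r0 vr] := res_w H0.
case: (@dval_unit_add _ _ _ _ val_v _ (evalp (eval1 cst w) u (drop_poly 1 H) * u) r0 vr) => //.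
apply: (vgeM val_v (m := 0) (n := 1)); last by right; rewrite vu.
by apply: (vge_eval2 val_v) => //; right; rewrite vu.
Qed.

(** A relation between [w], [z] and [u] that is not divisible by [u] reduces to a
    nontrivial relation between the residues of [w] and [z]. *)
Lemma residue_algebraic z : vge v 0 z ->
  exists2 P : {poly {poly k}}, P != 0 & vge v 1 (eval2 cst w z P).
Proof.
move=> z0; have [Q /poly_lowest_term [n [P [-> P0]]]] := dep w z u.
rewrite rmorphM /= rmorphXn /= {2}/eval3 evalpX.
move/eqP; rewrite mulf_eq0 (negPf (expf_neq0 _ u0)) orbF => /eqP.
rewrite (poly_coef0_drop P) rmorphD rmorphM /= /eval3 evalpC evalpX => E.
exists P`_0 => //; move/eqP: E; rewrite addr_eq0 => /eqP ->; apply: (vgeN val_v) => //.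
apply: (vgeM val_v (m := 0) (n := 1)); last by right; rewrite vu.
by apply: (vge_evalp val_v) => // [c|]; [apply: (vge_eval2 val_v)|right; rewrite vu].
Qed.

(** The reduction of [z] has a separable minimal equation over the reduction of
    [k(w)]: at a relation of least degree the derivative is a unit. *)
Lemma residue_separable z : vge v 0 z ->
  exists P : {poly {poly k}}, [/\ vge v 1 (eval2 cst w z P),
    eval2 cst w z P^`() != 0 & v (eval2 cst w z P^`()) = 0].
Proof.
move=> z0; have [P0 P0n0 P0z] := residue_algebraic z0.
pose good n := `[< exists P, [/\ P != 0, vge v 1 (eval2 cst w z P) & size P = n] >].
have ex_good : exists n, good n by exists (size P0); apply/asboolP; exists P0.
case: (ex_minnP ex_good) => n /asboolP [P [Pn0 Pz <-]] min_P.
have sP : (1 < size P)%N.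
  rewrite ltnNge; apply/negP => /size1_polyC PE.
  have c0 : P`_0 != 0 by apply: contra_neq Pn0 => E; rewrite PE E.
  have [r0 vr] := res_w c0; move: Pz; rewrite PE /eval2 evalpC.
  by move/(vge_nz r0); rewrite vr.
have P'n0 : P^`() != 0 by apply: deriv_neq0 sP; apply: pchar_poly0.
have P'small : ~ vge v 1 (eval2 cst w z P^`()).
  move=> P'z; have /min_P : good (size P^`()) by apply/asboolP; exists P^`().
  by rewrite leqNgt lt_size_deriv.
have P'0 : eval2 cst w z P^`() != 0 by apply/eqP => E; apply: P'small; left.
exists P; split => //; apply/eqP; rewrite eq_le.
rewrite (vge_nz P'0 (vge_eval2 val_v _ w_ge0 z0)) andbT -ltzD1 add0r ltNge.
by apply/negP => E; apply: P'small; right.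
Qed.

(** The poles that [D] creates on the whole valuation ring are bounded by those
    on the finitely many generators. *)
Lemma derivation_bounded (D : K -> K) : derivation cst D ->
  exists N : nat, forall z, vge v 0 z -> vge v (- N%:Z) (D z).
Proof.
move=> derD; have [n [a [a0 gen]]] := ft_v.
exists (\sum_i absz (v (D (a i))))%N; set N := (\sum_i _)%N.
have aN i : vge v (- N%:Z) (D (a i)).
  right; have : (absz (v (D (a i))) <= N)%N by rewrite /N (bigD1 i) //= leq_addr.
  by lia.
pose S z := vge v 0 z /\ vge v (- N%:Z) (D z).
have SM x y : S x -> S y -> S (x * y).
  move=> [x0 Dx] [y0 Dy]; split; first by rewrite -(addr0 0); apply: (vgeM val_v).
  rewrite (derivationM derD); apply: (vgeD val_v) => //.
    by rewrite -(addr0 (- _)); apply: (vgeM val_v).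
  by rewrite -(add0r (- _)); apply: (vgeM val_v).
have S1 c : S (cst c).
  by split; [apply: (vge_cst val_v)|rewrite (derivation_const derD); left].
have SF F : S (mmap cst a F).
  rewrite /mmap; elim/big_rec: _ => [|m x _ [x0 Dx]].
    by split; rewrite ?(derivation0 derD); left.
  have [y0 Dy] : S (cst F@_m * mmap1 a m).
    apply: (SM) => //; rewrite /mmap1; elim/big_rec: _ => [|i y _ Sy].
      by rewrite -(rmorph1 cst).
    apply: (SM) => //; elim: (m i) => [|j IH]; first by rewrite expr0 -(rmorph1 cst).
    by rewrite exprS; apply: (SM).
  by split; rewrite ?(derivationD derD); apply: (vgeD val_v).
move=> z /gen [F [G [G0 vG ->]]].
have [F0 DF] := SF F; have [_ DG] := SF G.
rewrite (derivation_div derD) //; apply: (vge_mulr val_v (b := mmap cst a G ^+ 2)).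
  by rewrite expf_neq0.
rewrite divfK ?expf_neq0 // (dvalX val_v) // vG mul0rn addr0.
have G00 : vge v 0 (mmap cst a G) by right; rewrite vG.
apply: (vgeB val_v) => //; first by rewrite -(addr0 (- _)); apply: (vgeM val_v).
by rewrite -(add0r (- _)); apply: (vgeM val_v).
Qed.

(** A pole of order [N] of [D] on the valuation ring would make [u ^ N * D]
    induce a nonzero derivation of the residue field over [k(w)], although the
    residue field is separably algebraic over [k(w)]. *)
Lemma derivation_regular (D : K -> K) : derivation cst D ->
  vge v 0 (D u) -> vge v 0 (D w) -> forall z, vge v 0 z -> vge v 0 (D z).
Proof.
move=> derD Du Dw; have [N] := derivation_bounded derD.
elim: N => [|N IH] // bound; apply: IH => z z0.
have [P [Pz P'0 vP']] := residue_separable z0.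
suff P'z : vge v (- N%:Z) (eval2 cst w z P^`() * D z).
  by apply: (vge_mulr val_v P'0); rewrite vP' addr0 mulrC.
have -> : eval2 cst w z P^`() * D z = D (eval2 cst w z P) -
    \sum_(i < size P) D (eval1 cst w P`_i) * z ^+ i.
  by rewrite /eval2 (derivation_evalp derD) addrK.
apply: (vgeB val_v) => //.
  have -> : eval2 cst w z P = u * (eval2 cst w z P / u) by rewrite mulrC divfK.
  have Pu : vge v 0 (eval2 cst w z P / u).
    by apply: (vge_mulr val_v u0); rewrite divfK // vu add0r.
  rewrite (derivationM derD); apply: (vgeD val_v) => //.
    by apply: (@vgeW _ _ _ 0); [lia|rewrite -(addr0 0); apply: (vgeM val_v)].
  have -> : - N%:Z = 1 + - N.+1%:Z by lia.
  by apply: (vgeM val_v) => //; [right; rewrite vu|apply: bound].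
apply: (@vgeW _ _ _ 0); first by lia.
apply: (vge_sum val_v) => // i; rewrite -(addr0 0).
apply: (vgeM val_v) => //; last exact: (vgeX val_v).
rewrite /= /eval1 (derivation_evalp_const derD); last exact: derivation_const.
by rewrite -(addr0 0); apply: (vgeM val_v) => //; apply: (vge_eval1 val_v).
Qed.

End RegularDerivations.

(** * The order of a two-form along a divisor *)

Section LogForms.
Variables (k K : fieldType) (cst : {rmorphism k -> K}) (v : K -> int).
Hypothesis val_v : dvaluation cst v.
Hypothesis pchar0 : [pchar k] =i pred0.
Hypothesis ft_v : finite_type cst v.
Hypothesis dep : forall z0 z1 z2 : K,
  exists2 P : {poly {poly {poly k}}}, P != 0 & eval3 cst z0 z1 z2 P = 0.
Variables u w : K.
Hypotheses (u0 : u != 0) (vu : v u = 1) (res_w : residue_transcendental cst v w).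

(** Every element is separably algebraic over [k(u, w)]. *)
Lemma derivation_eq0 (D : K -> K) : derivation cst D -> D u = 0 -> D w = 0 ->
  forall z, D z = 0.
Proof.
move=> derD Du Dw z.
pose good n := `[< exists P, [/\ P != 0, eval3 cst w u z P = 0 & size P = n] >].
have ex_good : exists n, good n.
  by have [P P0 Pz] := dep w u z; exists (size P); apply/asboolP; exists P.
case: (ex_minnP ex_good) => n /asboolP [P [Pn0 Pz <-]] min_P.
have sP : (1 < size P)%N.
  rewrite ltnNge; apply/negP => /size1_polyC PE.
  have c0 : P`_0 != 0 by apply: contra_neq Pn0 => E; rewrite PE E.
  move: Pz; rewrite PE /eval3 evalpC => /eqP.
  by rewrite (negPf (eval2_uniformizer_neq0 val_v u0 vu res_w c0)).
have P'n0 : P^`() != 0.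
  by apply: deriv_neq0 sP; do 2!apply: pchar_poly0.
have P'0 : eval3 cst w u z P^`() != 0.
  apply/eqP => P'z; have /min_P : good (size P^`()) by apply/asboolP; exists P^`().
  by rewrite leqNgt lt_size_deriv.
have Dwu c : D (eval2 cst w u c) = 0.
  rewrite /eval2 (derivation_evalp_const derD) ?Du ?mulr0 // => {}c.
  rewrite /eval1 (derivation_evalp_const derD) ?Dw ?mulr0 //.
  exact: derivation_const.
have := derivation_evalp_const derD P z Dwu.
rewrite -/(eval3 cst w u z P) Pz (derivation0 derD) => /esym/eqP.
by rewrite mulf_eq0 (negPf P'0) => /eqP.
Qed.

(** The claim is stable under products and inverses, so that it only has to be
    checked for the uniformizer and for units. *)
Lemma derivation_order (D : K -> K) (s : int) : derivation cst D ->
  (forall z, vge v 0 z -> vge v 0 (D z)) -> 0 <= s -> vge v (1 - s) (D u) ->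
  forall z, z != 0 -> vge v (v z - s) (D z).
Proof.
move=> derD reg s0 Du.
pose Q z := z != 0 /\ vge v (v z - s) (D z).
have QM a b : Q a -> Q b -> Q (a * b).
  move=> [a0 Da] [b0 Db]; split; first by rewrite mulf_neq0.
  rewrite (derivationM derD) (dvalM val_v) //; apply: (vgeD val_v).
    have -> : v a + v b - s = v a - s + v b by lia.
    by apply: (vgeM val_v) => //; apply: vge_refl.
  have -> : v a + v b - s = v a + (v b - s) by lia.
  by apply: (vgeM val_v) => //; apply: vge_refl.
have QV a : Q a -> Q a^-1.
  move=> [a0 Da]; split; first by rewrite invr_eq0.
  rewrite (derivationV derD) // (dvalV val_v) //.
  apply: (vge_mulr val_v (b := a ^+ 2)); first by rewrite expf_neq0.
  rewrite divfK ?expf_neq0 // (dvalX val_v) //; apply: (vgeN val_v).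
  by apply: vgeW Da; lia.
have Qu : Q u by split; rewrite // vu.
have Qn n : Q (u ^+ n).
  elim: n => [|n IH]; last by rewrite exprS; apply: QM.
  by rewrite expr0; split; rewrite ?oner_eq0 // (derivation1 derD); left.
have Qz (n : int) : Q (u ^ n) by case: n => n; [apply: Qn | apply/QV/Qn].
have vz (n : int) : v (u ^ n) = n.
  by case: n => n; rewrite ?NegzE /= ?(dvalV val_v) ?expf_neq0 // (dvalX val_v) // vu; lia.
move=> z z0; have un0 : u ^ (v z) != 0 by rewrite expfz_neq0.
have -> : z = u ^ v z * (z / u ^ v z) by rewrite mulrC divfK.
set e := z / _; have e0 : e != 0 by rewrite mulf_neq0 ?invr_eq0.
have ve : v e = 0 by rewrite /e (dvalM val_v) ?invr_eq0 // (dvalV val_v) // vz subrr.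
have Qe : Q e by split=> //; apply: (@vgeW _ _ _ 0); [lia|apply: reg; right; rewrite ve].
by case: (QM _ _ (Qz (v z)) Qe).
Qed.

Variables D0 D1 : K -> K.
Hypotheses (der0 : derivation cst D0) (der1 : derivation cst D1).
Hypothesis jac_nontrivial : exists a b, jac D0 D1 a b != 0.
Local Notation J := (jac D0 D1).

(** Otherwise [J z w] and [J z u] vanish for all [z]; then each derivation
    [J z b] of [z] kills [u] and [w], hence vanishes too. *)
Lemma jac_coordinates_neq0 : J u w != 0.
Proof.
apply/eqP => Juw; have [a [b /eqP]] := jac_nontrivial; apply.
have Jw := derivation_eq0 (jac_derivationl der0 der1 w) Juw (jac_self D0 D1 w).
have Ju z : J z u = 0.
  apply: (derivation_eq0 (jac_derivationl der0 der1 u)); first exact: jac_self.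
  by rewrite jacC Juw oppr0.
by apply: (derivation_eq0 (jac_derivationl der0 der1 b)); rewrite jacC ?Jw ?Ju oppr0.
Qed.

(** The form [dg/g /\ dh/h] has at most a simple pole along the divisor: in the
    coordinates [u] and [w], only [du] can contribute one. *)
Lemma jac_order g h : g != 0 -> h != 0 ->
  vge v (v g + v h - 1 + v (J u w)) (J g h).
Proof.
move=> g0 h0; have J0 := jac_coordinates_neq0.
pose E1 z := (J u w)^-1 * J z w; pose E2 z := (J u w)^-1 * J u z.
have d1 : derivation cst E1 := derivation_scale (jac_derivationl der0 der1 w) _.
have d2 : derivation cst E2 := derivation_scale (jac_derivationr der0 der1 u) _.
have E1u : E1 u = 1 by rewrite /E1 mulVf.
have E1w : E1 w = 0 by rewrite /E1 jac_self mulr0.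
have E2u : E2 u = 0 by rewrite /E2 jac_self mulr0.
have E2w : E2 w = 1 by rewrite /E2 mulVf.
have r1 : forall z, vge v 0 z -> vge v 0 (E1 z).
  apply: (derivation_regular val_v pchar0 ft_v dep u0 vu res_w d1).
    by rewrite E1u; apply: (vge1 val_v).
  by rewrite E1w; left.
have r2 : forall z, vge v 0 z -> vge v 0 (E2 z).
  apply: (derivation_regular val_v pchar0 ft_v dep u0 vu res_w d2).
    by rewrite E2u; left.
  by rewrite E2w; apply: (vge1 val_v).
have o1 z : z != 0 -> vge v (v z - 1) (E1 z).
  by apply: (derivation_order d1 r1) => //; rewrite E1u subrr; apply: (vge1 val_v).
have o2 z : z != 0 -> vge v (v z) (E2 z).
  by rewrite -[v z]subr0; apply: (derivation_order d2 r2) => //; rewrite E2u; left.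
have -> : J g h = (E1 g * E2 h - E1 h * E2 g) * J u w.
  apply: (mulIf J0); rewrite (jac_exchange D0 D1 g h u w) /E1 /E2; field.
  exact: J0.
apply: (vgeM val_v); last exact: vge_refl.
apply: (vgeB val_v).
  by rewrite addrAC; apply: (vgeM val_v); [apply: o1|apply: o2].
by rewrite (addrC (v g)) addrAC; apply: (vgeM val_v); [apply: o1|apply: o2].
Qed.

End LogForms.

(** * Polynomials in two coordinates *)

Definition derivx (A : nzRingType) (G : {poly {poly A}}) : {poly {poly A}} :=
  map_poly (@deriv A) G.

Lemma coef_derivx (A : nzRingType) (G : {poly {poly A}}) j : (derivx G)`_j = (G`_j)^`().
Proof. by rewrite coef_map_id0 ?deriv0. Qed.

(** [x] and [y] behave as coordinates of log discrepancy [A]: the two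
    inequalities are the log inequality for [dG /\ dy] and [dx /\ dG]. *)
Record log_coordinates (k K : fieldType) (cst : {rmorphism k -> K}) (v : K -> int)
    (A : int) (x y : K) : Prop := {
  log_coord_inj : forall G, G != 0 -> eval2 cst x y G != 0;
  log_coord_dx : forall G, derivx G != 0 ->
    v (eval2 cst x y G) + v y <= A + v (eval2 cst x y (derivx G));
  log_coord_dy : forall G, G^`() != 0 ->
    v (eval2 cst x y G) + v x <= A + v (eval2 cst x y G^`())
}.

Section JacobianCoordinates.
Variables (k K : fieldType) (cst : {rmorphism k -> K}).
Hypothesis pchar0 : [pchar k] =i pred0.
Variables D0 D1 : K -> K.
Hypotheses (der0 : derivation cst D0) (der1 : derivation cst D1).
Local Notation J := (jac D0 D1).

(** Differentiating a relation of least degree gives a smaller one. *)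
Lemma evalp_neq0 (A : idomainType) (phi : {rmorphism A -> K}) (D : K -> K) z :
  [pchar A] =i pred0 -> (forall c, c != 0 -> phi c != 0) ->
  derivation cst D -> (forall c, D (phi c) = 0) -> D z != 0 ->
  forall p, p != 0 -> evalp phi z p != 0.
Proof.
move=> ch0 inj derD Dphi Dz p; have [n] := ubnP (size p).
elim: n p => // n IH p; rewrite ltnS => sp p0.
have [sp1|sp1] := leqP (size p) 1.
  rewrite (size1_polyC sp1) evalpC; apply: inj.
  by apply: contra_neq p0 => E; rewrite (size1_polyC sp1) E.
apply/eqP => pz; have := derivation_evalp_const derD p z Dphi.
rewrite pz (derivation0 derD) => /esym/eqP; rewrite mulf_eq0 (negPf Dz) orbF.
apply/negP/IH; last exact: deriv_neq0.
by apply: leq_trans sp; apply: lt_size_deriv.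
Qed.

Variables (v : K -> int) (u w : K).
Hypothesis val_v : dvaluation cst v.
Hypothesis order_ineq : forall g h, g != 0 -> h != 0 ->
  vge v (v g + v h - 1 + v (J u w)) (J g h).

(** [A] is the log discrepancy with respect to the form [dx /\ dy]. *)
Lemma jac_log_coordinates x y : J x y != 0 ->
  log_coordinates cst v (1 + v (J x y) - v (J u w)) x y.
Proof.
move=> Jxy; have dl := jac_derivationl der0 der1 y; have dr := jac_derivationr der0 der1 x.
have x0 : x != 0 by apply: contra_neq Jxy => ->; rewrite (derivation0 dl).
have y0 : y != 0 by apply: contra_neq Jxy => ->; rewrite (derivation0 dr).
have inj1 : forall c, c != 0 -> eval1 cst x c != 0.
  apply: (evalp_neq0 _ _ dl) => // c; first by rewrite fmorph_eq0.
  exact: (derivation_const dl).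
have dr1 c : J x (eval1 cst x c) = 0.
  rewrite /eval1 (derivation_evalp_const dr) ?jac_self ?mulr0 // => {}c.
  exact: (derivation_const dr).
have inj2 : forall G, G != 0 -> eval2 cst x y G != 0.
  by apply: (evalp_neq0 _ _ dr) => //; apply: pchar_poly0.
split=> // G G'0.
- have G0 : G != 0 by apply: contra_neq G'0 => ->; rewrite /derivx map_poly0.
  have := order_ineq (inj2 G G0) y0.
  have -> : J (eval2 cst x y G) y = eval2 cst x y (derivx G) * J x y.
    rewrite /eval2 (derivation_evalp dl) jac_self mulr0 add0r.
    rewrite (@evalpE _ _ _ _ (size G)) ?size_poly // mulr_suml; apply: eq_bigr => i _.
    rewrite coef_derivx /= /eval1 (derivation_evalp_const dl); first by rewrite mulrAC.
    exact: (derivation_const dl).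
  move/(vge_nz _); rewrite mulf_neq0 ?inj2 // => /(_ isT).
  by rewrite (dvalM val_v) ?inj2 //; lia.
- have G0 : G != 0 by apply: contra_neq G'0 => ->; rewrite deriv0.
  have := order_ineq x0 (inj2 G G0).
  have -> : J x (eval2 cst x y G) = eval2 cst x y G^`() * J x y.
    by rewrite /eval2 (derivation_evalp_const dr).
  move/(vge_nz _); rewrite mulf_neq0 ?inj2 // => /(_ isT).
  by rewrite (dvalM val_v) ?inj2 //; lia.
Qed.

(** Blowing up the origin lowers the log discrepancy by the order of the
    exceptional curve. *)
Lemma jac_blowup x y : x != 0 -> J x (y / x) = J x y / x.
Proof.
move=> x0; rewrite (derivation_div (jac_derivationr der0 der1 x)) // jac_self.
by rewrite mulr0 subr0; field.
Qed.

End JacobianCoordinates.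

(** * Bounding the order of a polynomial by its monomials *)

Section MonomialBounds.
Variables (k K : fieldType) (cst : {rmorphism k -> K}) (v : K -> int).
Hypothesis val_v : dvaluation cst v.
Hypothesis pchar0 : [pchar k] =i pred0.
Local Notation ev x y := (eval2 cst x y).
Implicit Types (G : {poly {poly k}}) (A : int) (x y : K).

Lemma coef_iter_derivx n G i j :
  (iter n (@derivx k) G)`_j`_i = G`_j`_(n + i) *+ (n + i) ^_ n.
Proof.
elim: n i => [|n IH] i; first by rewrite mulr1n.
by rewrite iterS coef_derivx coef_deriv IH addSnnS -mulrnA ffactnSr addKn.
Qed.

Lemma order_chain_step (X Y Z a b c A : int) :
  X + b <= a + Y -> Y + c <= A + Z -> X + (c + b) <= A + a + Z.
Proof. lia. Qed.

Lemma order_chain_end (X Y a b c e : int) :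
  X + b <= a + Y -> Y + c <= e -> X <= e - c + (a - b).
Proof. lia. Qed.

Lemma log_coord_iter_dx A x y G n : log_coordinates cst v A x y ->
  iter n (@derivx k) G != 0 ->
  v (ev x y G) + v y *+ n <= A *+ n + v (ev x y (iter n (@derivx k) G)).
Proof.
move=> coord; elim: n => [|n IH]; first by rewrite !mulr0n addr0 add0r.
rewrite iterS; move: (iter n _ G) IH => H IH H'0.
have /IH le_n : H != 0 by apply: contra_neq H'0 => ->; rewrite /derivx map_poly0.
by rewrite !mulrS; apply: order_chain_step le_n (log_coord_dx coord H'0).
Qed.

Lemma log_coord_iter_dy A x y G n : log_coordinates cst v A x y ->
  G^`(n) != 0 -> v (ev x y G) + v x *+ n <= A *+ n + v (ev x y G^`(n)).
Proof.
move=> coord; elim: n => [|n IH]; first by rewrite derivn0 !mulr0n addr0 add0r.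
rewrite derivnS; move: (G^`(n)) IH => H IH H'0.
have /IH le_n : H != 0 by apply: contra_neq H'0 => ->; rewrite deriv0.
by rewrite !mulrS; apply: order_chain_step le_n (log_coord_dy coord H'0).
Qed.

Lemma dval_origin_unit x y G : vge v 1 x -> vge v 1 y -> G`_0`_0 != 0 ->
  v (ev x y G) = 0.
Proof.
move=> x1 y1 c0; rewrite (poly_coef0_drop G) rmorphD rmorphM /= /eval2 evalpC evalpX.
rewrite (poly_coef0_drop G`_0) rmorphD rmorphM /= /eval1 evalpC evalpX -addrA.
have x0 := vgeW (isT : 0 <= 1 :> int) x1; have y0 := vgeW (isT : 0 <= 1 :> int) y1.
case: (dval_unit_add val_v (a := cst G`_0`_0) (b := evalp cst x (drop_poly 1 G`_0) * x +
   evalp (eval1 cst x) y (drop_poly 1 G) * y)) => //.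
- by rewrite fmorph_eq0.
- exact: dval_const c0.
apply: (vgeD val_v); apply: (vgeM val_v (m := 0) (n := 1)) => //.
  by apply: (vge_evalp val_v) => // c; apply: (vge_cst val_v).
by apply: (vge_evalp val_v) => // c; apply: (vge_eval1 val_v).
Qed.

(** A derivation that removes the monomial [x ^ i * y ^ j] costs at most [A - v y]
    for each factor [x] and [A - v x] for each factor [y], and leaves a unit. *)
Lemma dval_le_monomial A x y G i j : log_coordinates cst v A x y ->
  vge v 1 x -> vge v 1 y -> G`_j`_i != 0 ->
  v (ev x y G) <= (A - v y) *+ i + (A - v x) *+ j.
Proof.
move=> coord x1 y1 c0; pose H := iter i (@derivx k) G^`(j).
have H0 : H`_0`_0 != 0.
  rewrite coef_iter_derivx coef_derivn !addn0 coefMn -mulrnA -mulr_natr mulf_neq0 //.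
  by rewrite ((pcharf0P k).1 pchar0) !ffactnn -lt0n muln_gt0 !fact_gt0.
have Hn0 : H != 0 by apply: contra_neq H0 => ->; rewrite !coef0.
have Gn0 : G^`(j) != 0.
  apply: contra_neq Hn0 => E; apply/polyP => l; apply/polyP => n.
  by rewrite /H coef_iter_derivx E !coef0 mul0rn.
have := log_coord_iter_dx coord Hn0; rewrite (dval_origin_unit x1 y1 H0) addr0 => le1.
have le2 := log_coord_iter_dy coord Gn0.
by rewrite !mulrnBl; apply: order_chain_end le2 le1.
Qed.

(** For [m] the multiplicity of [G] at the origin, this is the strict transform
    of [G] in the chart [y = x * y'] of the blow-up. *)
Definition blowup_poly (m : nat) G : {poly {poly k}} :=
  \poly_(j < size G) drop_poly m ('X^j * G`_j).

Lemma coef_blowup_poly m G j i :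
  (blowup_poly m G)`_j`_i = if (i + m < j)%N then 0 else G`_j`_(i + m - j).
Proof.
rewrite coef_poly; case: ltnP => [_|jG]; first by rewrite coef_drop_poly coefXnM.
by rewrite (nth_default _ jG) !coef0 if_same.
Qed.

Lemma eval_blowup_poly m G x y : x != 0 ->
  (forall i j, G`_j`_i != 0 -> (m <= i + j)%N) ->
  ev x y G = x ^+ m * ev x (y / x) (blowup_poly m G).
Proof.
move=> x0 mG; rewrite /eval2 evalp_poly (evalpE _ _ (leqnn _)) mulr_sumr.
apply: eq_bigr => j _ /=.
have E : eval1 cst x (drop_poly m ('X^j * G`_j)) * x ^+ m = x ^+ j * eval1 cst x G`_j.
  rewrite -[RHS](_ : eval1 cst x ('X^j * G`_j) = _); last first.
    by rewrite rmorphM /= /eval1 evalpXn.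
  rewrite -[in RHS](poly_take_drop m ('X^j * G`_j)).
  have -> : take_poly m ('X^j * G`_j) = 0.
    apply/polyP => i; rewrite coef_take_poly coefXnM coef0.
    case: ltnP => // im; case: ltnP => // ji; apply/eqP; apply: contraTT im => /mG.
    by rewrite subnK // -leqNgt.
  by rewrite add0r rmorphM /= {3}/eval1 evalpXn.
rewrite mulrA [x ^+ m * _]mulrC E [x ^+ j * _]mulrC -mulrA -exprMn.
by rewrite [x * _]mulrC divfK.
Qed.
End MonomialBounds.

(** * Valuations centred at a point or along a line *)

Definition total_degree_le (A : nzRingType) (d : nat) (F : {poly {poly A}}) : Prop :=
  forall i j, F`_j`_i != 0 -> (i + j <= d)%N.

Section PointBounds.
Variables (k : closedFieldType) (K : fieldType) (cst : {rmorphism k -> K}).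
Variable v : K -> int.
Hypothesis val_v : dvaluation cst v.
Hypothesis pchar0 : [pchar k] =i pred0.
Local Notation ev x y := (eval2 cst x y).
Implicit Types (G F : {poly {poly k}}) (A : int) (x y : K).

(** Over an algebraically closed field it suffices to test linear polynomials. *)
Lemma transcendental_residue x :
  (forall c, x - cst c != 0 /\ v (x - cst c) = 0) -> residue_transcendental cst v x.
Proof.
move=> xc q q0; have [rs qE] := closed_field_poly_normal q.
have lc : lead_coef q != 0 by rewrite lead_coef_eq0.
rewrite qE -mul_polyC rmorphM /= {1 3}/eval1 evalpC rmorph_prod /=.
have [P0 vP] : \prod_(i <- rs) eval1 cst x ('X - i%:P) != 0 /\
    v (\prod_(i <- rs) eval1 cst x ('X - i%:P)) = 0.
  elim: rs {qE} => [|c rs [IH0 IH]].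
    by rewrite big_nil oner_eq0 (dval1 val_v).
  have [c0 vc] := xc c; have E : eval1 cst x ('X - c%:P) = x - cst c.
    by rewrite rmorphB /= /eval1 evalpX evalpC.
  by rewrite !big_cons E mulf_neq0 // (dvalM val_v) // vc IH.
by rewrite mulf_neq0 ?fmorph_eq0 // (dvalM val_v) ?fmorph_eq0 // vP (dval_const val_v).
Qed.

(** The valuation sees only the restriction of [G] to the axis, a polynomial in
    one transcendental residue. *)
Lemma dval_along_x_axis x y G : residue_transcendental cst v x -> vge v 1 y ->
  G`_0 != 0 -> v (ev x y G) = 0.
Proof.
move=> res_x y1 G0; rewrite (poly_coef0_drop G) rmorphD rmorphM /= /eval2 evalpC evalpX.
have [r0 vr] := res_x _ G0.
case: (dval_unit_add val_v r0 vr (b := evalp (eval1 cst x) y (drop_poly 1 G) * y)) => //.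
have x0 := vge_residue_transcendental res_x.
apply: (vgeM val_v (m := 0) (n := 1)) => //.
apply: (vge_evalp val_v) => // [c|]; first exact: (vge_eval1 val_v).
by apply: vgeW y1.
Qed.

Lemma dval_along_y_axis x y G j : residue_transcendental cst v y -> vge v 1 x ->
  G`_j`_0 != 0 -> v (ev x y G) = 0.
Proof.
move=> res_y x1 G0; pose n := size G.
pose G0y : {poly k} := \poly_(i < n) G`_i`_0.
pose G1 : {poly {poly k}} := \poly_(i < n) drop_poly 1 G`_i.
have -> : ev x y G = eval1 cst y G0y + ev x y G1 * x.
  rewrite /eval2 /eval1 !evalp_poly (evalpE _ _ (leqnn _)) mulr_suml -big_split /=.
  apply: eq_bigr => i _; rewrite mulrAC -mulrDl; congr (_ * _).
  by rewrite {1}(poly_coef0_drop G`_i) rmorphD rmorphM /= /eval1 evalpC evalpX.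
have G0y0 : G0y != 0.
  apply: contra_neq G0 => /(congr1 (fun q : {poly k} => q`_j)).
  rewrite coef0 coef_poly; case: ltnP => // jn _.
  by rewrite (nth_default _ jn) coef0.
have [r0 vr] := res_y _ G0y0.
case: (dval_unit_add val_v r0 vr (b := ev x y G1 * x)) => //.
have y0 := vge_residue_transcendental res_y.
apply: (vgeM val_v (m := 0) (n := 1)) => //.
by apply: (vge_eval2 val_v) => //; apply: vgeW x1.
Qed.

Lemma factor_axis r F : (forall j, (j < r)%N -> F`_j = 0) -> F = drop_poly r F * 'X^r.
Proof.
move=> Fr; rewrite -[LHS](poly_take_drop r F).
have -> : take_poly r F = 0.
  by apply/polyP => i; rewrite coef_take_poly coef0; case: ltnP => // /Fr.
by rewrite add0r.
Qed.

Lemma dval_factor_axis x y r F : y != 0 -> ev x y (drop_poly r F) != 0 ->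
  (forall j, (j < r)%N -> F`_j = 0) ->
  v (ev x y F) = v (ev x y (drop_poly r F)) + v y *+ r.
Proof.
move=> y0 g0 Fr; rewrite {1}(factor_axis Fr) rmorphM /= rmorphXn /= {2}/eval2 evalpX.
by rewrite (dvalM val_v) ?expf_neq0 // (dvalX val_v).
Qed.

Lemma multiplicity_exists G : G != 0 -> exists m,
  (forall i j, G`_j`_i != 0 -> (m <= i + j)%N) /\
  exists i j, G`_j`_i != 0 /\ (i + j = m)%N.
Proof.
move=> G0; pose good n := `[< exists i j, G`_j`_i != 0 /\ (i + j = n)%N >].
have ex_good : exists n, good n.
  exists ((size (lead_coef G)).-1 + (size G).-1)%N; apply/asboolP.
  exists (size (lead_coef G)).-1, (size G).-1; split=> //.
  by rewrite -lead_coefE -lead_coefE !lead_coef_eq0.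
case: (ex_minnP ex_good) => m /asboolP good_m min_m; exists m; split=> // i j Gij.
by apply: min_m; apply/asboolP; exists i, j.
Qed.

(** The first bound on [V] comes from the multiplicity [m] of a curve, the second
    from its intersection number [i] with the tangent line.  When [b] is at most
    [A / 2] their mean is good enough, otherwise the second one is. *)
Lemma tangent_arith (A a b V : int) (r i m n d : nat) :
  0 <= a -> a <= b -> a + b <= A -> (m <= i)%N -> (i <= n)%N -> (n + r = d)%N ->
  V <= (A - a) *+ m -> V <= a *+ m + (A - b) *+ (i - m) ->
  (V + b *+ r) *+ 2 <= A *+ maxn d (2 * r).
Proof.
move=> a0 ab abA mi ni nrd; rewrite -nrd -[(A - a) *+ m]mulr_natr -[a *+ m]mulr_natr.
rewrite -[(A - b) *+ _]mulr_natr natrB // -[b *+ r]mulr_natr -[_ *+ 2]mulr_natr.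
rewrite -[A *+ _]mulr_natr => V1 V2.
have mi' : m%:R <= i%:R :> int by rewrite ler_nat.
have ni' : i%:R <= n%:R :> int by rewrite ler_nat.
have m0 : 0 <= m%:R :> int by rewrite ler0n.
have r0 : 0 <= r%:R :> int by rewrite ler0n.
have max1 : n%:R + r%:R <= (maxn (n + r) (2 * r))%:R :> int by rewrite -natrD ler_nat leq_maxl.
have max2 : 2 * r%:R <= (maxn (n + r) (2 * r))%:R :> int by rewrite -natrM ler_nat leq_maxr.
clear mi ni nrd.
move: (m%:R) (i%:R) (n%:R) (r%:R) ((maxn (n + r) (2 * r))%:R)
  V1 V2 mi' ni' m0 r0 max1 max2 => {}m {}i {}n {}r M.
move=> V1 V2 mi ni m0 r0 max1 max2.
have [hb|hb] := leP (b * 2) A.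
  apply: (@le_trans _ _ (A * (n + r))); last by nia.
  have : b * (i - m) >= 0 by nia.
  have : (A - b * 2) * r >= 0 by nia.
  have : A * (n - i) >= 0 by nia.
  by nia.
have V3 : V <= (A - b) * n.
  have : (A - b - a) * m >= 0 by nia.
  have : (A - b) * (n - i) >= 0 by nia.
  by nia.
have [rn|nr] := leP r n.
  apply: (@le_trans _ _ (A * (n + r))); last by nia.
  have : (b * 2 - A) * (n - r) >= 0 by nia.
  by nia.
apply: (@le_trans _ _ (A * (2 * r))); last by nia.
have : (A - b) * (r - n) >= 0 by nia.
by nia.
Qed.

Lemma log_coord_neq0 A x y : log_coordinates cst v A x y -> x != 0 /\ y != 0.
Proof.
move=> coord; split.
  have <- : ev x y ('X%:P) = x by rewrite /eval2 evalpC /= /eval1 evalpX.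
  by apply: (log_coord_inj coord); rewrite polyC_eq0 polyX_eq0.
have <- : ev x y 'X = y by rewrite /eval2 evalpX.
by apply: (log_coord_inj coord); rewrite polyX_eq0.
Qed.

Lemma log_coord_sum A x y : log_coordinates cst v A x y -> v x + v y <= A.
Proof.
move=> coord; have E : derivx ('X%:P : {poly {poly k}}) = 1.
  by apply/polyP => -[|i]; rewrite coef_derivx !coefC /= ?derivX ?deriv0.
have := log_coord_dx (G := 'X%:P) coord; rewrite E rmorph1 (dval1 val_v) addr0.
by rewrite /eval2 evalpC /= /eval1 evalpX oner_eq0; apply.
Qed.

(** The line [y = 0] is the tangent direction of the divisor at its centre.  With
    [F = y ^ r * g], a monomial of least degree [m] of [g] bounds the order of [g]
    by [m * (A - v x)].  After a blow-up, where the log discrepancy is [A - v x],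
    the lowest monomial of [g] on the line bounds the order of the strict
    transform by [(i - m) * (A - v y)]. *)
Lemma dval_le_point A x y F d r : log_coordinates cst v A x y ->
  log_coordinates cst v (A - v x) x (y / x) ->
  1 <= v x -> v x < v y -> total_degree_le d F -> F`_r != 0 ->
  (forall j, (j < r)%N -> F`_j = 0) ->
  v (ev x y F) *+ 2 <= A *+ maxn d (2 * r).
Proof.
move=> coord coord1 vx vxy degF Fr Fr0; pose g := drop_poly r F.
have g00 : g`_0 != 0 by rewrite coef_drop_poly.
have g0 : g != 0 by apply: contra_neq g00 => ->; rewrite coef0.
have [m [mg [i1 [j1 [gij ijm]]]]] := multiplicity_exists g0.
pose i := (size g`_0).-1.
have gi : g`_0`_i != 0 by rewrite -lead_coefE lead_coef_eq0.
have id : (i + r <= d)%N by apply: degF; move: gi; rewrite /g coef_drop_poly.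
have mi : (m <= i)%N by rewrite -(addn0 i); apply: mg.
have x1 : vge v 1 x by right.
have y1 : vge v 1 y by right; lia.
have [x0 y0] := log_coord_neq0 coord.
have gK0 : ev x y g != 0 := log_coord_inj coord g0.
rewrite (dval_factor_axis y0 gK0 Fr0).
apply: (@tangent_arith A (v x) (v y) _ r i m (d - r) d) => //.
- by apply: le_trans vx.
- exact: ltW.
- exact: log_coord_sum coord.
- by rewrite leq_subRL ?(leq_trans _ id) ?leq_addl // addnC.
- by rewrite subnK // (leq_trans _ id) ?leq_addl.
- apply: le_trans (dval_le_monomial val_v pchar0 coord x1 y1 gij) _.
  rewrite -ijm mulrnDr lerD2r lerMn2r lerD2l lerN2 (ltW vxy) orbT //.
have E := eval_blowup_poly cst y x0 mg.
have g10 : ev x (y / x) (blowup_poly m g) != 0.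
  by apply: contra_neq gK0; rewrite E => ->; rewrite mulr0.
rewrite E (dvalM val_v) ?expf_neq0 // (dvalX val_v) // lerD2l.
have g1i : (blowup_poly m g)`_0`_(i - m) != 0.
  by rewrite coef_blowup_poly subnK // subn0.
have vyx : v (y / x) = v y - v x.
  by rewrite (dvalM val_v) ?invr_eq0 // (dvalV val_v).
have yx1 : vge v 1 (y / x) by right; rewrite vyx lerBrDr lez1D.
apply: le_trans (dval_le_monomial val_v pchar0 coord1 x1 yx1 g1i) _.
rewrite mulr0n addr0 vyx; suff -> : A - v x - (v y - v x) = A - v y by [].
by rewrite opprB addrA subrK.
Qed.

(** The centre is a point at which no tangent direction is special, so that the
    order of [F] is its multiplicity times the order of [x]. *)
Lemma dval_le_ordinary A x y F d : log_coordinates cst v A x y -> v x = v y -> 1 <= v x ->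
  residue_transcendental cst v (y / x) -> total_degree_le d F -> F != 0 ->
  v (ev x y F) *+ 2 <= A *+ d.
Proof.
move=> coord vxy vx res degF F0.
have [m [mF [i [j [Fij ijm]]]]] := multiplicity_exists F0.
have [x0 y0] := log_coord_neq0 coord.
have E := eval_blowup_poly cst y x0 mF.
have F10 : ev x (y / x) (blowup_poly m F) != 0.
  by apply: contra_neq (log_coord_inj coord F0); rewrite E => ->; rewrite mulr0.
have F1j : (blowup_poly m F)`_j`_0 != 0.
  by rewrite coef_blowup_poly add0n -ijm ltnNge leq_addl addnK.
have x1 : vge v 1 x by right.
rewrite E (dvalM val_v) ?expf_neq0 // (dvalX val_v) // (dval_along_y_axis res x1 F1j) addr0.
have md : (m <= d)%N by rewrite -ijm; apply: degF.
have := log_coord_sum coord; rewrite -vxy -mulr2n => le_A.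
have A0 : 0 <= A by apply: le_trans le_A; rewrite mulrn_wge0 // (le_trans _ vx).
rewrite -mulrnA mulnC mulrnA; apply: (@le_trans _ _ (A *+ m)).
  by rewrite lerMn2r le_A orbT.
by rewrite ler_wpMn2l.
Qed.

(** The centre is the line [y = 0], which occurs [r] times in [F]. *)
Lemma dval_le_line A x y F d r : log_coordinates cst v A x y ->
  residue_transcendental cst v x -> 1 <= v y -> F`_r != 0 ->
  (forall j, (j < r)%N -> F`_j = 0) ->
  v (ev x y F) *+ 2 <= A *+ maxn d (2 * r).
Proof.
move=> coord res vy Fr Fr0; have [x0 y0] := log_coord_neq0 coord.
have g00 : (drop_poly r F)`_0 != 0 by rewrite coef_drop_poly.
have g0 : drop_poly r F != 0 by apply: contra_neq g00 => ->; rewrite coef0.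
have y1 : vge v 1 y by right.
rewrite (dval_factor_axis y0 (log_coord_inj coord g0) Fr0).
rewrite (dval_along_x_axis res y1 g00) add0r.
have vx : v x = 0 by have [_] := res _ (negbT (polyX_eq0 k)); rewrite /eval1 evalpX.
have := log_coord_sum coord; rewrite vx add0r => le_A.
have A0 : 0 <= A by apply: le_trans le_A; apply: le_trans vy.
rewrite -mulrnA mulnC; apply: (@le_trans _ _ (A *+ (2 * r))).
  by rewrite lerMn2r le_A orbT.
by rewrite ler_wpMn2l // leq_maxr.
Qed.
End PointBounds.

(** * Valuations centred along a curve of higher degree *)

Section TotalDegree.
Variable k : fieldType.
Implicit Types F G : {poly {poly k}}.

(** Substituting [X * T] for the inner and [T] for the outer variable: the degree
    in [T] of the result is the total degree, and it is additive on products. *)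
Definition graded F : {poly {poly k}} :=
  evalp (evalp (@polyC {poly k} \o @polyC k) ('X%:P * 'X)) 'X F.

Lemma gradedM F G : graded (F * G) = graded F * graded G.
Proof. exact: rmorphM. Qed.

Lemma coef_graded_coef (p : {poly k}) l :
  (evalp (@polyC {poly k} \o @polyC k) ('X%:P * 'X) p)`_l = p`_l *: 'X^l.
Proof.
rewrite (evalpE _ _ (leqnn _)) coef_sum.
have E (i : 'I_(size p)) :
    ((@polyC {poly k} \o @polyC k) p`_i * ('X%:P * 'X) ^+ i)`_l =
    if l == i then p`_l *: 'X^l else 0.
  rewrite exprMn -rmorphXn /= mulrA -rmorphM /= coefCM coefXn mul_polyC.
  by case: eqP => [->|_]; rewrite ?mulr1 ?mulr0.
rewrite (eq_bigr _ (fun i _ => E i)) -big_mkcond /=.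
have [lp|pl] := ltnP l (size p); first by rewrite (big_pred1 (Ordinal lp)).
rewrite big_pred0 ?nth_default ?scale0r // => i.
by apply/eqP => li; rewrite li leqNgt ltn_ord in pl.
Qed.

Lemma coef_graded F n i :
  (graded F)`_n`_i = if (i <= n)%N then F`_(n - i)`_i else 0.
Proof.
rewrite /graded (@evalpE _ _ _ _ (n.+1 + size F)) ?leq_addl // !coef_sum.
have E (j : 'I_(n.+1 + size F)) : (evalp (@polyC {poly k} \o @polyC k) ('X%:P * 'X) F`_j *
    'X^j)`_n`_i = if (i <= n)%N && (j == n - i :> nat)%N then F`_(n - i)`_i else 0.
  rewrite coefMXn; case: ltnP => [nj|jn].
    by rewrite coef0 gtn_eqF ?andbF // (leq_ltn_trans (leq_subr i n)).
  rewrite coef_graded_coef coefZ coefXn.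
  case: leqP => /= [le_in|lt_ni]; last first.
    by rewrite gtn_eqF ?mulr0 // (leq_ltn_trans (leq_subr j n)).
  case: (j =P (n - i)%N :> nat) => [->|ne]; first by rewrite subKn // eqxx mulr1.
  by case: eqP => [E|_]; [case: ne; rewrite E subKn|rewrite mulr0].
rewrite (eq_bigr _ (fun j _ => E j)) -big_mkcond /=.
case: leqP => le_in /=; last by rewrite big_pred0.
have lt : (n - i < n.+1 + size F)%N by lia.
by rewrite (big_pred1 (Ordinal lt)).
Qed.

Lemma size_graded_le d F : total_degree_le d F -> (size (graded F) <= d.+1)%N.
Proof.
move=> degF; apply/leq_sizeP => n dn; apply/polyP => i; rewrite coef_graded coef0.
case: leqP => // le_in; apply/eqP; apply: contraTT dn => /degF.
by rewrite subnKC // -ltnNge.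
Qed.

Lemma size_graded_ge F d : (size (graded F) <= d.+1)%N -> total_degree_le d F.
Proof.
move=> sF i j; apply: contra_neqT; rewrite -ltnNge => d_ij.
have := coef_graded F (i + j) i; rewrite leq_addr addKn => <-.
by rewrite (nth_default _ (leq_trans sF d_ij)) coef0.
Qed.
End TotalDegree.

Section Gauss.
Variable k : closedFieldType.
Implicit Types F G P : {poly {poly k}}.

(** [P] does not vanish on a line parallel to the [y]-axis. *)
Definition vertical_free P : Prop := forall c : k, exists j, (P`_j).[c] != 0.

Lemma vertical_factor P (c : k) : (forall j, (P`_j).[c] = 0) ->
  exists Q, P = ('X - c%:P) *: Q.
Proof.
move=> Pc; exists (\poly_(j < size P) (P`_j %/ ('X - c%:P))).
apply/polyP => j; rewrite coefZ coef_poly; case: ltnP => [_|jP]; last first.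
  by rewrite (nth_default _ jP) mulr0.
by rewrite mulrC divpK // dvdp_XsubCl /root Pc.
Qed.

(** Gauss's lemma: the denominators of a quotient by a polynomial without
    vertical factor cancel, one root at a time. *)
Lemma Gauss_cancel P Q F (c : {poly k}) : vertical_free P -> c != 0 ->
  c *: F = Q * P -> exists G, F = G * P.
Proof.
move=> vP; have [n] := ubnP (size c); elim: n c Q => // n IH c Q; rewrite ltnS => sc c0 E.
have [sc1|sc1] := leqP (size c) 1.
  move: c0 E; rewrite (size1_polyC sc1) polyC_eq0; move: (c`_0) => e e0 E.
  by exists (e^-1%:P *: Q); rewrite -scalerAl -E scalerA -polyCM mulVf // scale1r.
have [z /factor_theorem [c' cE]] : exists z, root c z.
  by apply/closed_rootP; rewrite neq_ltn sc1 orbT.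
have [Q' QE] : exists Q', Q = ('X - z%:P) *: Q'.
  apply: vertical_factor.
  pose h := map_poly (horner_eval z) : {poly {poly k}} -> {poly k}.
  have hP : h P != 0.
    have [j Pj] := vP z; apply: contra_neq Pj => /(congr1 (fun q : {poly k} => q`_j)).
    by rewrite coef_map coef0.
  have : h Q * h P = 0.
    rewrite /h -rmorphM -E cE /= -mul_polyC rmorphM /= map_polyC /= /horner_eval.
    by rewrite hornerM hornerXsubC subrr mulr0 polyC0 mul0r.
  move/eqP; rewrite mulf_eq0 (negPf hP) orbF => /eqP hQ j.
  by rewrite -[LHS](coef_map (horner_eval z)) [map_poly _ _]hQ coef0.
have c'0 : c' != 0 by apply: contra_neq c0 => c'0; rewrite cE c'0 mul0r.
apply: (IH c' Q') => //.
  move: sc; rewrite cE size_mul ?polyXsubC_eq0 // size_XsubC addn2 /=; exact: leq_trans.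
have X0 : ('X - z%:P)%:P != 0 :> {poly {poly k}} by rewrite polyC_eq0 polyXsubC_eq0.
apply: (mulfI X0); rewrite !mul_polyC scalerA mulrC -cE E QE.
by rewrite scalerAl.
Qed.
End Gauss.

Section CurveBound.
Variables (k : closedFieldType) (K : fieldType) (cst : {rmorphism k -> K}).
Variable v : K -> int.
Hypothesis val_v : dvaluation cst v.
Hypothesis pchar0 : [pchar k] =i pred0.
Local Notation ev x y := (eval2 cst x y).
Implicit Types (G F : {poly {poly k}}) (A : int).

(** The centre is a curve of degree at least 2.  Its equation [P] is found as a
    polynomial of positive order with least degree in [y], so that whatever
    vanishes on the curve is divisible by [P] up to a factor in [x].  The order
    of [P] is at most [A]; since the total degree of [P] is at least 2, at most
    half the degree of [F] counts. *)
Lemma dval_le_curve A x y F d : log_coordinates cst v A x y ->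
  (forall a b c, [|| a != 0, b != 0 | c != 0] -> v (cst a + cst b * x + cst c * y) = 0) ->
  total_degree_le d F -> F != 0 -> v (ev x y F) *+ 2 <= A *+ d.
Proof.
move=> coord lin degF F0; have [x0 y0] := log_coord_neq0 coord.
have inj := log_coord_inj coord.
have vx : v x = 0.
  by have := lin 0 1 0; rewrite oner_eq0 orbT !rmorph0 rmorph1 add0r mul1r mul0r addr0; apply.
have vy : v y = 0.
  by have := lin 0 0 1; rewrite oner_eq0 !orbT !rmorph0 rmorph1 add0r mul1r mul0r add0r; apply.
have xc c : x - cst c != 0 /\ v (x - cst c) = 0.
  have E : ev x y ('X - c%:P)%:P = x - cst c.
    by rewrite /eval2 evalpC rmorphB /= /eval1 evalpX evalpC.
  split; first by rewrite -E inj // polyC_eq0 polyXsubC_eq0.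
  have := lin (- c) 1 0; rewrite oner_eq0 orbT rmorph0 rmorph1 rmorphN mul1r mul0r addr0.
  by rewrite addrC; apply.
have res_x := transcendental_residue val_v xc.
have A0 : 0 <= A by have := log_coord_sum val_v coord; rewrite vx vy.
pose V G := v (ev x y G).
have V0 G : G != 0 -> 0 <= V G.
  move=> G0; apply: (vge_nz (inj G G0)); apply: (vge_eval2 val_v); right.
    by rewrite vx.
  by rewrite vy.
have VM G H : G != 0 -> H != 0 -> V (G * H) = V G + V H.
  by move=> G0 H0; rewrite /V rmorphM (dvalM val_v) ?inj.
have VC c : c != 0 -> V c%:P = 0.
  by move=> c0; rewrite /V /eval2 evalpC; case: (res_x c c0).
case: (EM (exists G, G != 0 /\ 0 < V G)) => [[G0 [nG0 VG0]]|noG]; last first.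
  have -> : v (ev x y F) = 0.
    apply/eqP; rewrite eq_le -/(V F) V0 // andbT leNgt; apply/negP => VF.
    by apply: noG; exists F.
  by rewrite mul0rn mulrn_wge0.
pose good n := `[< exists G, [/\ G != 0, 0 < V G & size G = n] >].
have ex_good : exists n, good n by exists (size G0); apply/asboolP; exists G0.
case: (ex_minnP ex_good) => n /asboolP [G1 [nG1 VG1 sG1]] min_n.
have small G : G != 0 -> (size G < n)%N -> V G = 0.
  move=> nG sG; apply/eqP; rewrite eq_le V0 // andbT leNgt; apply/negP => VG.
  by move: sG; rewrite ltnNge min_n //; apply/asboolP; exists G.
(* A leading coefficient of least degree leaves no vertical factor in [P]. *)
pose good2 m := `[< exists G, [/\ G != 0, 0 < V G, size G = n & size (lead_coef G) = m] >].
have ex_good2 : exists m, good2 m by exists (size (lead_coef G1)); apply/asboolP; exists G1.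
case: (ex_minnP ex_good2) => m /asboolP [P [P0 VP sP sl]] min_m {G0 nG0 VG0 G1 nG1 VG1 sG1}.
have vfree : vertical_free P.
  move=> c; apply: contrapT => /forallNP Pc.
  have [Q QE] : exists Q, P = ('X - c%:P) *: Q.
    by apply: vertical_factor => j; apply/eqP/negPn/negP/Pc.
  have Q0 : Q != 0 by apply: contra_neq P0 => E; rewrite QE E scaler0.
  have Xc0 : 'X - c%:P != 0 :> {poly k} by rewrite polyXsubC_eq0.
  have sQ : size Q = n by rewrite -sP QE size_scale.
  have VQ : 0 < V Q.
    by move: VP; rewrite QE -mul_polyC VM ?polyC_eq0 // VC // add0r.
  have : good2 (size (lead_coef Q)) by apply/asboolP; exists Q.
  move/min_m; rewrite -sl QE lead_coefZ size_mul ?lead_coef_eq0 // size_XsubC add2n /=.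
  by rewrite ltnn.
have sP1 : (1 < size P)%N.
  rewrite ltnNge; apply/negP => /size1_polyC PE; move: VP; rewrite PE VC ?ltxx //.
  by apply: contra_neq P0 => E; rewrite PE E.
have VPA : V P <= A.
  have P'0 : P^`() != 0 by apply: deriv_neq0 sP1; apply: pchar_poly0.
  have := log_coord_dy coord P'0; rewrite vx addr0 -/(V P) -/(V P^`()).
  by rewrite (small _ P'0) ?addr0 // -sP lt_size_deriv.
have div G : G != 0 -> 0 < V G -> exists Q, G = Q * P.
  move=> G0 VG; pose c := lead_coef P ^+ scalp G P.
  have c0 : c != 0 by rewrite expf_neq0 // lead_coef_eq0.
  have E : c *: G = G %/ P * P + G %% P := Pdiv.Idomain.divp_eq G P.
  apply: (Gauss_cancel (Q := G %/ P) vfree c0); rewrite E.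
  case: (eqVneq (G %% P) 0) => [->|r0]; first by rewrite addr0.
  have sr : (size (G %% P)%R < n)%N by rewrite -sP Pdiv.Idomain.ltn_modp.
  suff : vge v 1 (ev x y (G %% P)) by move/(vge_nz (inj _ r0)); rewrite -/(V _) small.
  have -> : G %% P = c%:P * G - G %/ P * P by rewrite mul_polyC E addrC addKr.
  have ev0 H : vge v 0 (ev x y H).
    by apply: (vge_eval2 val_v); right; rewrite ?vx ?vy.
  rewrite rmorphB !rmorphM; apply: (vgeB val_v); apply: (vgeM val_v (m := 0) (n := 1)).
  - exact: ev0.
  - by right.
  - exact: ev0.
  - by right.
have main e G : G != 0 -> (size (graded G) <= e.+1)%N -> V G *+ 2 <= A *+ e.
  have [N] := ubnP e; elim: N e G => // N IH e G; rewrite ltnS => eN G0 sG.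
  case: (ltP 0 (V G)) => [VG|VG]; last first.
    apply: (@le_trans _ _ 0); last by rewrite mulrn_wge0.
    by rewrite mulrn_wle0.
  have [Q GE] := div G G0 VG.
  have Q0 : Q != 0 by apply: contra_neq G0 => E; rewrite GE E mul0r.
  have gr0 H : H != 0 -> graded H != 0.
    apply: contra_neq => E; have : (size (graded H) <= 0)%N by rewrite E size_poly0.
    move=> sH; have d0 := size_graded_ge (leq_trans sH (leq0n 1)).
    apply/polyP => j; apply/polyP => i; rewrite !coef0.
    have := coef_graded H (i + j) i; rewrite E !coef0 leq_addr addKn.
    by move/esym.
  have gP : (2 < size (graded P))%N.
    rewrite ltnNge; apply/negP => /size_graded_ge deg1.
    pose a := P`_0`_0; pose b := P`_0`_1; pose c := P`_1`_0.
    have zero i j : (2 <= i + j)%N -> P`_j`_i = 0.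
      by move=> ij; apply/eqP; apply: contraTT ij => /deg1; rewrite -ltnNge.
    have PE : P = (a%:P + b%:P * 'X)%:P + c%:P%:P * 'X.
      apply/polyP => j; apply/polyP => i; rewrite coefD coefC coefMX coefC.
      case: j => [|[|j]] /=; last by rewrite add0r coef0 zero // addnS addnS.
        by rewrite addr0 coefD coefC coefMX coefC; case: i => [|[|i]] /=;
          rewrite ?addr0 ?add0r // zero // addn0.
      by rewrite add0r coefC; case: i => [|i] //=; rewrite zero // addn1.
    have VE : V P = v (cst a + cst b * x + cst c * y).
      rewrite /V PE /eval2 rmorphD rmorphM /= !evalpC evalpX /=.
      by rewrite /eval1 rmorphD rmorphM /= !evalpC evalpX.
    move: VP; rewrite VE lin ?ltxx //; apply: contraNT P0; rewrite !negb_or !negbK.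
    by move=> /and3P [/eqP a0 /eqP b0 /eqP c0]; rewrite PE a0 b0 c0 !polyC0 !mul0r !addr0.
  have arith p q : (2 < p -> 0 < q -> (p + q).-1 <= e.+1 -> q <= (e - 2).+1 /\ 2 <= e)%N.
    by clear; lia.
  have [sQ e2] : (size (graded Q) <= (e - 2).+1 /\ 2 <= e)%N.
    apply: arith gP _ _; first by rewrite lt0n size_poly_eq0 gr0.
    have -> : (size (graded P) + size (graded Q)).-1 = size (graded G).
      by rewrite addnC -size_mul ?gr0 // GE gradedM.
    exact: sG.
  have := IH (e - 2)%N Q; rewrite GE VM // mulrnDl => IHQ.
  rewrite -(subnK e2) mulrnDr lerD ?IHQ //; first by lia.
  by rewrite lerMn2r VPA orbT.
exact: main F0 (size_graded_le degF).
Qed.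
End CurveBound.

(** * The function field of the plane *)

HB.instance Definition _ (k : fieldType) := GRing.RMorphism.copy (@ff_const k)
  (@tofrac {mpoly k[2]} \o @mpolyC 2 k).

Section PlaneField.
Variable k : fieldType.
Local Notation K := (plane_field k).
Implicit Types (a b z : K).

Lemma frac_reprE z :
  z = tofrac (frac (repr z)).1 / tofrac (frac (repr z)).2.
Proof.
have q1 : tofrac (frac (repr z)).2 != 0 :> plane_field k.
  by rewrite tofrac_eq0 denom_ratioP.
apply: (mulIf q1); rewrite divfK // -{1}[z]reprK.
case: (repr z) {q1} => [[p q] /= q0].
unlock tofrac; rewrite !piE; apply/eqmodP => /=.
rewrite /FracField.equivf /FracField.mulf /= !numden_Ratio ?mulf_neq0 ?oner_eq0 //.
by rewrite !mulr1 mulrC.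
Qed.

Lemma plane_field_fraction z :
  exists p q : {mpoly k[2]}, q != 0 /\ z = tofrac p / tofrac q.
Proof.
by exists (frac (repr z)).1, (frac (repr z)).2; rewrite denom_ratioP -frac_reprE.
Qed.

Lemma ff_deriv_fraction (i : 'I_2) (p q : {mpoly k[2]}) : q != 0 ->
  ff_deriv i (tofrac p / tofrac q) =
  tofrac (p^`M(i) * q - p * q^`M(i)) / tofrac (q ^+ 2).
Proof.
move=> q0; rewrite /ff_deriv; set z := tofrac p / _.
have := frac_reprE z; have := denom_ratioP (repr z).
move: (frac (repr z)).1 (frac (repr z)).2 => n m m0 Ez.
have E : n * q = p * m.
  apply/eqP; rewrite -(tofrac_eq (n * q)) !tofracM -[_ * _ == _]eqr_div ?tofrac_eq0 //.
  by rewrite -Ez.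
have := congr1 (fun r => r^`M(i)) E; rewrite !mderivM => E'.
apply/eqP; rewrite eqr_div ?tofrac_eq0 ?expf_neq0 // -!tofracM tofrac_eq -subr_eq0.
set n' := n^`M(i) in E' *; set m' := m^`M(i) in E' *.
set p' := p^`M(i) in E' *; set q' := q^`M(i) in E' *.
have -> : (n' * m - n * m') * q ^+ 2 - (p' * q - p * q') * m ^+ 2 =
  m * q * ((n' * q + n * q') - (p' * m + p * m')) - (m' * q + q' * m) * (n * q - p * m).
  by ring.
by rewrite E' E !subrr !mulr0 subrr.
Qed.

Lemma ff_deriv_derivation (i : 'I_2) : derivation (@ff_const k) (ff_deriv i).
Proof.
split.
- move=> a b; case: (plane_field_fraction a) => p [q [q0 ->]].
  case: (plane_field_fraction b) => r [s [s0 ->]].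
  rewrite addf_div ?tofrac_eq0 // -!tofracM -tofracD !ff_deriv_fraction ?mulf_neq0 //.
  rewrite addf_div ?tofrac_eq0 ?expf_neq0 // -!tofracM -tofracD exprMn.
  by congr (tofrac _ / _); rewrite !(mderivM, mderivD); ring.
- move=> a b; case: (plane_field_fraction a) => p [q [q0 ->]].
  case: (plane_field_fraction b) => r [s [s0 ->]].
  rewrite mulf_div -!tofracM !ff_deriv_fraction ?mulf_neq0 //.
  rewrite [X in _ = X + _]mulf_div [X in _ = _ + X]mulf_div.
  rewrite addf_div ?mulf_neq0 ?tofrac_eq0 ?expf_neq0 // -!tofracM -tofracD.
  apply/eqP; rewrite eqr_div ?tofrac_eq0 ?mulf_neq0 ?expf_neq0 // -!tofracM.
  by apply/eqP; congr tofrac; rewrite !mderivM; ring.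
- by move=> c; rewrite ff_deriv_tofrac mderivC tofrac0.
Qed.

Lemma jacobian_xy : jacobian (ff_x k) (ff_y k) = 1.
Proof.
rewrite /jacobian /ff_x /ff_y !ff_deriv_tofrac !mderivX !mnm1E /=.
have subU i : (U_(i) - U_(i) = 0 :> 'X_{1..2})%MM by apply/mnmP => j; rewrite mnmBE subnn mnm0E.
by rewrite !scale0r !scale1r !subU !mpolyX0 tofrac1 tofrac0 !mulr0 mulr1 subr0.
Qed.
End PlaneField.

(** * Algebraic dependence *)

Section Dependence.
Variable k : fieldType.
Local Notation K := (plane_field k).

Lemma linear_dependence_card (T S : finType) (M : T -> S -> k) :
  (#|S| < #|T|)%N ->
  exists c : T -> k, (exists t, c t != 0) /\ forall s, \sum_t c t * M t s = 0.
Proof.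
move=> ST; pose A := \matrix_(i < #|T|, j < #|S|) M (enum_val i) (enum_val j).
have : kermx A != 0.
  rewrite kermx_eq0 /row_free neq_ltn.
  by rewrite (leq_ltn_trans (rank_leq_col A) ST).
case/rowV0Pn => v /sub_kermxP vA v0.
exists (fun t => v 0 (enum_rank t)); split.
  case/rV0Pn: v0 => i vi; exists (enum_val i); by rewrite enum_valK.
move=> s; have /matrixP/(_ 0 (enum_rank s)) := vA.
rewrite !mxE => E; rewrite -[RHS]E (reindex (@enum_val T predT)) /=; last first.
  exact/onW_bij/enum_val_bij.
by apply: eq_bigr => i _; rewrite enum_valK !mxE enum_rankK.
Qed.

Lemma msizeM_bound (p q : {mpoly k[2]}) e f :
  (msize p <= e.+1)%N -> (msize q <= f.+1)%N -> (msize (p * q) <= (e + f).+1)%N.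
Proof.
move=> pe qf; case: (eqVneq p 0) => [->|p0]; first by rewrite mul0r msize0.
case: (eqVneq q 0) => [->|q0]; first by rewrite mulr0 msize0.
rewrite msizeM // -subn1 leq_subLR; apply: leq_trans (leq_add pe qf) _; lia.
Qed.

Lemma msizeX_bound (p : {mpoly k[2]}) e n :
  (msize p <= e.+1)%N -> (msize (p ^+ n) <= (e * n).+1)%N.
Proof.
move=> pe; elim: n => [|n IH]; first by rewrite expr0 msize1.
by rewrite exprS mulnS msizeM_bound.
Qed.

Lemma clear_denominators (F : comNzRingType) (i j l n : nat) (a b c d : F) :
  (i + j + l <= n)%N ->
  (a * d) ^+ i * (b * d) ^+ j * (c * d) ^+ l * d ^+ (n - i - j - l) =
  d ^+ n * (a ^+ i * b ^+ j * c ^+ l).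
Proof.
move=> le; have {2}-> : n = (i + j + l + (n - i - j - l))%N by lia.
rewrite !exprMn !exprD; move: (a ^+ i) (b ^+ j) (c ^+ l) => {}a {}b {}c.
by move: (d ^+ i) (d ^+ j) (d ^+ l) (d ^+ _) => x y z w; ring.
Qed.

(** With a common denominator [q], the products z0^i z1^j z2^l with i, j, l < N,
    multiplied by q^(3N), are N^3 polynomials in two variables whose degree is
    linear in N: for large N there are more of them than monomials. *)
Lemma algebraic_dependence (z0 z1 z2 : K) :
  exists2 P : {poly {poly {poly k}}}, P != 0 & eval3 (@ff_const k) z0 z1 z2 P = 0.
Proof.
have [q [p0 [p1 [p2 [q0 E0 E1 E2]]]]] : exists q p0 p1 p2 : {mpoly k[2]},
    [/\ q != 0, z0 = tofrac p0 / tofrac q, z1 = tofrac p1 / tofrac q &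
        z2 = tofrac p2 / tofrac q].
  case: (plane_field_fraction z0) => a0 [b0 [nb0 ->]].
  case: (plane_field_fraction z1) => a1 [b1 [nb1 ->]].
  case: (plane_field_fraction z2) => a2 [b2 [nb2 ->]].
  exists (b0 * b1 * b2), (a0 * b1 * b2), (a1 * b0 * b2), (a2 * b0 * b1).
  rewrite !mulf_neq0 //; split=> //; rewrite !tofracM;
    apply/eqP; rewrite eqr_div ?mulf_neq0 ?tofrac_eq0 // -!tofracM tofrac_eq;
    apply/eqP; ring.
have [e [le_q le_p0 le_p1 le_p2]] : exists e : nat,
    [/\ msize q <= e.+1, msize p0 <= e.+1, msize p1 <= e.+1 & msize p2 <= e.+1]%N.
  move: (msize q) (msize p0) (msize p1) (msize p2) => n0 n1 n2 n3.
  by exists (n0 + n1 + n2 + n3)%N; split; lia.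
(* There are [N ^ 3] products and at most [B ^ 2] monomials of degree below [B]:
   [N] has to exceed [(3 * e + 1) ^ 2], which is at most [16 * e ^ 2 + 1]. *)
pose N := (16 * e * e + 17)%N; pose B := (3 * e * N).+1.
pose T := ('I_N * 'I_N * 'I_N)%type; pose S := ('I_B * 'I_B)%type.
pose M (t : T) : {mpoly k[2]} :=
  p0 ^+ t.1.1 * p1 ^+ t.1.2 * p2 ^+ t.2 * q ^+ (3 * N - t.1.1 - t.1.2 - t.2).
have MB t : (msize (M t) <= B)%N.
  have -> : B = (e * t.1.1 + e * t.1.2 + e * t.2
                 + e * (3 * N - t.1.1 - t.1.2 - t.2)).+1.
    rewrite /B -!mulnDr mulnAC mulnC; congr (_ * _).+1.
    have := ltn_ord t.1.1; have := ltn_ord t.1.2; have := ltn_ord t.2; lia.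
  by rewrite /M !msizeM_bound ?msizeX_bound.
have ME t : tofrac (M t) = tofrac q ^+ (3 * N) * (z0 ^+ t.1.1 * z1 ^+ t.1.2 * z2 ^+ t.2).
  have qF : tofrac q != 0 :> K by rewrite tofrac_eq0.
  rewrite /M !tofracM !tofracXn -(@clear_denominators _ _ _ _ _ z0 z1 z2) ?E0 ?E1 ?E2 ?divfK //.
  by have := ltn_ord t.1.1; have := ltn_ord t.1.2; have := ltn_ord t.2; lia.
have card : (#|{: S}| < #|{: T}|)%N.
  rewrite !card_prod !card_ord; rewrite /B /N; nia.
pose mon (s : S) : 'X_{1..2} := [multinom [tuple val s.1; val s.2]].
have [c [[t0 ct0] cM]] := linear_dependence_card (fun t s => (M t)@_(mon s)) card.
have {}cM : \sum_t c t *: M t = 0.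
  apply/mpolyP => m; rewrite mcoeff0 raddf_sum /=.
  under eq_bigr do rewrite mcoeffZ.
  have [lt_m|ge_m] := ltnP (mdeg m) B; last first.
    rewrite big1 // => t _; rewrite [_@_m]memN_msupp_eq0 ?mulr0 //.
    by rewrite msize_mdeg_ge // (leq_trans (MB t)).
  have m01 : (m ord0 < B)%N /\ (m ord_max < B)%N.
    move: lt_m; rewrite mdegE big_ord_recl big_ord1 => lt_m.
    have -> : ord_max = lift ord0 ord0 :> 'I_2 by apply: val_inj.
    split; lia.
  have := cM (Ordinal m01.1, Ordinal m01.2).
  suff -> : mon (Ordinal m01.1, Ordinal m01.2) = m by [].
  apply/mnmP => i; rewrite /mon (mnm_nth 0) /=.
  by case: i => [[|[|//]] i_lt] /=; congr (m _); apply: val_inj.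
pose ct (i j l : nat) : k :=
  if (insub i, insub j, insub l) is (Some i', Some j', Some l') then c (i', j', l') else 0.
have ctE (i j l : 'I_N) : ct i j l = c (i, j, l) by rewrite /ct !valK.
exists (\poly_(l < N) \poly_(j < N) \poly_(i < N) ct i j l).
  apply/eqP => /(congr1 (fun P : {poly {poly {poly k}}} => P`_t0.2`_t0.1.2`_t0.1.1)).
  do 3! rewrite coef0 coef_poly ltn_ord; rewrite ctE -!surjective_pairing => /eqP.
  by rewrite (negPf ct0).
have qN : tofrac q ^+ (3 * N) != 0 :> K by rewrite expf_neq0 // tofrac_eq0.
apply: (mulfI qN); rewrite mulr0 -[RHS](@tofrac0 {mpoly k[2]}) -cM rmorph_sum /=.
have sumT (G : T -> K) : \sum_t G t = \sum_i \sum_j \sum_l G (i, j, l).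
  by rewrite !pair_bigA; apply: eq_bigr => [[[i j] l]].
rewrite sumT.
rewrite /eval3 evalp_poly mulr_sumr.
under eq_bigr => l _.
  rewrite /= /eval2 evalp_poly mulr_suml mulr_sumr.
  under eq_bigr => j _.
    rewrite /= /eval1 evalp_poly !mulr_suml mulr_sumr.
    under eq_bigr => i _.
      have -> : tofrac q ^+ (3 * N) * (ff_const (ct i j l) * z0 ^+ i * z1 ^+ j * z2 ^+ l)
        = tofrac (c (i, j, l) *: M (i, j, l)).
        rewrite -mul_mpolyC tofracM ME /= ctE -/(ff_const _).
        by move: (ff_const _) (z0 ^+ i) (z1 ^+ j) (z2 ^+ l) => a b d e'; rewrite [RHS]mulrCA !mulrA.
      over.
    over.
  over.
rewrite exchange_big; under eq_bigr do rewrite exchange_big.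
by rewrite exchange_big; apply: eq_bigr => i _; apply: eq_bigr => j _.
Qed.
End Dependence.

(** * The action on forms *)

Lemma mmap_comp (k : fieldType) (S : comNzRingType) (phi : {rmorphism k -> S}) n m
    (a : 'I_m -> S) (t : n.-tuple {mpoly k[m]}) (g : {mpoly k[n]}) :
  mmap phi a (g \mPo t) = mmap phi (fun i => mmap phi a (tnth t i)) g.
Proof.
rewrite comp_mpolyE raddf_sum /= [RHS]/mmap; apply: eq_bigr => e _.
by rewrite mmapZ rmorph_prod /=; congr (_ * _); apply: eq_bigr => i _; rewrite rmorphXn.
Qed.

Section FormAction.
Variables (k : fieldType) (d : nat).
Implicit Types (A B : 'M[k]_3) (f g : ternary_form k d).

Lemma form_actM A B g : form_act A (form_act B g) = form_act (A *m B) g.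
Proof.
apply: val_inj => /=; rewrite {1}/comp_mpoly mmap_comp /comp_mpoly; congr mmap.
apply/funext => i; rewrite !tnth_mktuple raddf_sum /=.
under eq_bigr do rewrite mmapZ mmapX mmap1U tnth_mktuple mul_mpolyC scaler_sumr.
rewrite exchange_big; apply: eq_bigr => j _ /=.
by rewrite mxE scaler_suml; apply: eq_bigr => l _; rewrite scalerA mulrC.
Qed.

Lemma form_act1 g : form_act 1%:M g = g.
Proof.
apply: val_inj => /=; rewrite -[RHS]comp_mpoly_id; congr comp_mpoly.
apply/eq_from_tnth => i; rewrite !tnth_mktuple (bigD1 i) //= mxE eqxx scale1r.
by rewrite big1 ?addr0 // => j ji; rewrite mxE (negPf ji) scale0r.
Qed.

Lemma form_act_linear A c f g : form_act A (c *: f + g) = c *: form_act A f + form_act A g.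
Proof. by apply: val_inj => /=; rewrite !linearP. Qed.

Lemma form_act_eq0 A f : A \in unitmx -> (form_act A f == 0) = (f == 0).
Proof.
move=> uA; have act0 B : form_act B (0 : ternary_form k d) = 0.
  by apply: val_inj; rewrite /= raddf0.
apply/eqP/eqP => [E|->]; last exact: act0.
by rewrite -(form_act1 f) -(mulVmx uA) -form_actM E act0.
Qed.

Lemma form_act_scale A c f : form_act (c *: A) f = c ^+ d *: form_act A f.
Proof.
apply: val_inj => /=; rewrite !comp_mpolyEX scaler_sumr big_seq [RHS]big_seq.
apply: eq_bigr => m mf; rewrite !comp_mpolyX scalerA mulrC -scalerA; congr (_ *: _).
have <- : mdeg m = d by move/dhomogP: (dhomog_is_dhomog f); apply.
rewrite mdegE -prodrXr -[RHS]mul_mpolyC rmorph_prod -big_split /=; apply: eq_bigr => i _.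
rewrite !tnth_mktuple rmorphXn -exprMn; congr (_ ^+ _).
by rewrite mul_mpolyC scaler_sumr; apply: eq_bigr => j _; rewrite mxE scalerA.
Qed.
End FormAction.

(** * Quotients of linear forms *)

Lemma det_mx33 (R : comNzRingType) (M : 'M[R]_3) :
  let i0 := ord0 in let i1 := lift ord0 ord0 : 'I_3 in let i2 := ord_max in
  \det M = M i0 i0 * (M i1 i1 * M i2 i2 - M i1 i2 * M i2 i1)
         - M i0 i1 * (M i1 i0 * M i2 i2 - M i1 i2 * M i2 i0)
         + M i0 i2 * (M i1 i0 * M i2 i1 - M i1 i1 * M i2 i0).
Proof.
move=> i0 i1 i2; have E2 : i2 = lift ord0 (lift ord0 ord0) by apply: val_inj.
have D2 (B : 'M[R]_2) : \det B = B ord0 ord0 * B (lift ord0 ord0) (lift ord0 ord0) -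
    B ord0 (lift ord0 ord0) * B (lift ord0 ord0) ord0.
  rewrite (expand_det_row _ ord0) !big_ord_recl big_ord0 addr0 /cofactor !det_mx11 !mxE.
  rewrite /= expr0 expr1 mul1r mulN1r mulrN.
  by congr (_ * B _ _ - _ * B _ _); apply: val_inj.
rewrite (expand_det_row _ ord0) !big_ord_recl big_ord0 addr0 /cofactor !D2 !mxE -E2.
have -> : lift i1 ord0 = i0 by apply: val_inj.
have -> : lift i1 (lift ord0 ord0) = i2 by apply: val_inj.
have -> : lift i2 ord0 = i0 by apply: val_inj.
have -> : lift i2 (lift ord0 ord0) = i1 by apply: val_inj.
rewrite -/i0 -/i1 /= /bump /= !addn0 !add0n; ring.
Qed.

Lemma jacobian_ratio_identity (F : fieldType) (x y a0 a1 a2 b0 b1 b2 c0 c1 c2 : F) :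
  let l0 := a0 * x + b0 * y + c0 in let l1 := a1 * x + b1 * y + c1 in
  let l2 := a2 * x + b2 * y + c2 in l2 != 0 ->
  (a0 * l2 - l0 * a2) / l2 ^+ 2 * ((b1 * l2 - l1 * b2) / l2 ^+ 2) -
  (b0 * l2 - l0 * b2) / l2 ^+ 2 * ((a1 * l2 - l1 * a2) / l2 ^+ 2) =
  (a0 * (b1 * c2 - b2 * c1) - a1 * (b0 * c2 - b2 * c0) + a2 * (b0 * c1 - b1 * c0)) / l2 ^+ 3.
Proof.
move=> l0 l1 l2 l20; apply: (mulIf (expf_neq0 4 l20)).
have -> u v w z : u / l2 ^+ 2 * (v / l2 ^+ 2) - w / l2 ^+ 2 * (z / l2 ^+ 2) =
  (u * v - w * z) / l2 ^+ 4 :> F by field.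
rewrite divfK ?expf_neq0 //; have -> u : u / l2 ^+ 3 * l2 ^+ 4 = u * l2 :> F by field.
by rewrite /l0 /l1 /l2; ring.
Qed.

Section LinearForms.
Variable k : fieldType.
Local Notation K := (plane_field k).

Definition homog_coord (i : 'I_3) : K := [:: ff_x k; ff_y k; 1]`_i.

Definition linform (N : 'M[k]_3) (i : 'I_3) : K :=
  \sum_j ff_const (N j i) * homog_coord j.

Lemma dehomogenize_form_act d (N : 'M[k]_3) (g : ternary_form k d) :
  dehomogenize (form_act N g) = ff_eval (linform N) g.
Proof.
rewrite /dehomogenize [mpoly_of_dhomog _]/= /ff_eval mmap_comp; congr mmap.
apply/funext => i; rewrite tnth_mktuple raddf_sum /=; apply: eq_bigr => j _.
by rewrite mmapZ mmapX mmap1U.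
Qed.

Local Notation i0 := (ord0 : 'I_3).
Local Notation i1 := (lift ord0 ord0 : 'I_3).
Local Notation i2 := (ord_max : 'I_3).

Lemma linformE N i :
  linform N i = ff_const (N i0 i) * ff_x k + ff_const (N i1 i) * ff_y k + ff_const (N i2 i).
Proof.
rewrite /linform !big_ord_recl big_ord0 addr0 /homog_coord /= mulr1 addrA.
by congr (_ + ff_const (N _ _)); apply: val_inj.
Qed.

Lemma linform_mul N E i :
  linform (N *m E) i = \sum_j ff_const (E j i) * linform N j.
Proof.
rewrite /linform; under [RHS]eq_bigr do rewrite mulr_sumr.
rewrite exchange_big; apply: eq_bigr => j _; rewrite mxE rmorph_sum mulr_suml.
by apply: eq_bigr => l _; rewrite rmorphM /= mulrA (mulrC (ff_const (E _ _))).
Qed.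

Lemma ff_deriv_linform N i :
  ff_deriv ord0 (linform N i) = ff_const (N i0 i) /\
  ff_deriv ord_max (linform N i) = ff_const (N i1 i).
Proof.
have dX (e j : 'I_2) : ff_deriv e (tofrac 'X_j) = (j == e)%:R :> K.
  rewrite ff_deriv_tofrac mderivX mnm1E; case: eqP => [->|_]; last by rewrite scale0r tofrac0.
  have -> : (U_(e) - U_(e) = 0 :> 'X_{1..2})%MM.
    by apply/mnmP => l; rewrite mnmBE subnn mnm0E.
  by rewrite scale1r mpolyX0 tofrac1.
have d e a b c : ff_deriv e (ff_const a * ff_x k + ff_const b * ff_y k + ff_const c) =
    ff_const a * ff_deriv e (ff_x k) + ff_const b * ff_deriv e (ff_y k).
  have de := ff_deriv_derivation k e.
  by rewrite !(derivationD de) !(derivationM de) !(derivation_const de) !mul0r !add0r addr0.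
rewrite linformE !d /ff_x /ff_y !dX /=.
by rewrite !mulr1 !mulr0 addr0 add0r.
Qed.

Lemma jacobian_linform N : linform N i2 != 0 ->
  jacobian (linform N i0 / linform N i2) (linform N i1 / linform N i2) =
  ff_const (\det N) / linform N i2 ^+ 3.
Proof.
move=> l2; have d0 := ff_deriv_derivation k ord0; have d1 := ff_deriv_derivation k ord_max.
rewrite /jacobian !(derivation_div d0) // !(derivation_div d1) //.
have [-> ->] := ff_deriv_linform N i0; have [-> ->] := ff_deriv_linform N i1.
have [-> ->] := ff_deriv_linform N i2.
move: l2; rewrite !linformE => l2; rewrite jacobian_ratio_identity // det_mx33.
by congr (_ / _); rewrite !(rmorphD, rmorphN, rmorphM).
Qed.

End LinearForms.

(** * Forms in an affine chart *)

Section Chart.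
Variables (k : fieldType) (d : nat).
Local Notation K := (plane_field k).
Local Notation i0 := (ord0 : 'I_3).
Local Notation i1 := (lift ord0 ord0 : 'I_3).
Local Notation i2 := (ord_max : 'I_3).
Implicit Types f : ternary_form k d.

Definition chart f : {poly {poly k}} :=
  mmap (@polyC {poly k} \o @polyC k) (fun i : 'I_3 => [:: 'X%:P; 'X; 1]`_i) f.

Lemma coef_chart f i j :
  (chart f)`_j`_i = \sum_(m <- msupp f | (m i1 == j) && (m i0 == i)) f@_m.
Proof.
rewrite /chart /mmap !coef_sum [RHS]big_mkcond /=; apply: eq_bigr => m _.
rewrite /mmap1 !big_ord_recl big_ord0 mulr1 /= expr1n mulr1.
rewrite -rmorphXn mulrA -rmorphM /= coefCM coefXn.
case: eqVneq => _ /=; last by rewrite mulr0 coef0.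
by rewrite mulr1 coefCM coefXn; case: eqVneq => _; rewrite ?mulr1 ?mulr0.
Qed.

Lemma msupp_form f m : m \in msupp f -> (m i0 + m i1 + m i2 = d)%N.
Proof.
move=> mf; have <- : mdeg m = d by move/dhomogP: (dhomog_is_dhomog f); apply.
rewrite mdegE !big_ord_recl big_ord0 addn0 addnA.
by congr (_ + m _)%N; apply: val_inj.
Qed.

Lemma chart_total_degree f : total_degree_le d (chart f).
Proof.
move=> i j; apply: contra_neqT; rewrite -ltnNge => dij.
rewrite coef_chart big_seq_cond big_pred0 // => m.
apply/negP => /andP [/msupp_form E /andP [/eqP mj /eqP mi]].
by move: dij; rewrite -mj -mi -E ltnNge leq_addr.
Qed.

Lemma chart_coef f m : m \in msupp f -> (chart f)`_(m i1)`_(m i0) != 0.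
Proof.
move=> mf; rewrite coef_chart big_mkcond (bigD1_seq m) ?msupp_uniq //= !eqxx /=.
rewrite big1_seq ?addr0 -?mcoeff_msupp // => e /andP [em ef].
case: eqP => //= e1; case: eqP => //= e0; case/eqP: em.
have e2 : e i2 = m i2.
  by apply/eqP; rewrite -(eqn_add2l (m i0 + m i1)) (msupp_form mf) -e0 -e1 (msupp_form ef).
apply/mnmP => -[[|[|[|//]]] l]; [move: e0|move: e1|move: e2];
  by congr (_ = _); congr (fun_of_multinom _ _); apply: val_inj.
Qed.

Lemma chart_neq0 f : f != 0 -> chart f != 0.
Proof.
move=> f0; have : msupp f != [::] by rewrite msupp_eq0.
case E: (msupp f) => [//|m s] _; have /chart_coef : m \in msupp f by rewrite E mem_head.
by apply: contra_neq => ->; rewrite !coef0.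
Qed.

Lemma eval_chart f (x y z : K) : z != 0 ->
  ff_eval (fun i : 'I_3 => [:: x; y; z]`_i) f =
  z ^+ d * eval2 (@ff_const k) (x / z) (y / z) (chart f).
Proof.
move=> z0; rewrite /chart /ff_eval /mmap rmorph_sum mulr_sumr /= big_seq [RHS]big_seq.
apply: eq_bigr => m mf; rewrite rmorphM /= {1}/eval2 evalpC /= /eval1 evalpC mulrCA.
congr (_ * _); rewrite /mmap1 !big_ord_recl !big_ord0 !mulr1 /= expr1n mulr1.
rewrite rmorphM !rmorphXn /= /eval2 evalpC evalpX /= /eval1 evalpX.
rewrite -{1}(msupp_form mf) !exprD !expr_div_n.
have -> : lift ord0 (lift ord0 ord0) = i2 by apply: val_inj.
have cancel (F : fieldType) (a b c s t : F) : a != 0 -> b != 0 ->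
    s * (t * c) = a * b * c * (s / a * (t / b)).
  by move=> a0 b0; field; rewrite ?a0 ?b0.
by apply: cancel; rewrite expf_neq0.
Qed.
End Chart.

(** * Affine coordinates adapted to a divisor *)

Section AdaptedCoordinates.
Variables (k : closedFieldType) (v : plane_field k -> int) (u w : plane_field k).
Hypothesis pchar0 : [pchar k] =i pred0.
Hypotheses (div_v : divisor_over_plane v) (coord_uw : coordinates_along v u w).
Local Notation K := (plane_field k).
Local Notation i0 := (ord0 : 'I_3).
Local Notation i1 := (lift ord0 ord0 : 'I_3).
Local Notation i2 := (ord_max : 'I_3).
Local Notation cst := (@ff_const k).
Local Notation mco := (min_coord_order v).
Implicit Types N : 'M[k]_3.

Definition log_discrepancy := 1 + discrepancy v u w.
Local Notation A := log_discrepancy.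

Lemma divisor_dvaluation : dvaluation cst v.
Proof. by case: div_v => [[_ v2 v3 v4] _]; split. Qed.

Let val_v := divisor_dvaluation.

Lemma jacobian_order g h : g != 0 -> h != 0 ->
  vge v (v g + v h - 1 + v (jacobian u w)) (jacobian g h).
Proof.
have [_ ft] := div_v; case: coord_uw => u0 vu res_w.
apply: (jac_order val_v pchar0 ft (@algebraic_dependence k) u0 vu res_w
  (ff_deriv_derivation k ord0) (ff_deriv_derivation k ord_max)).
exists (ff_x k), (ff_y k).
by have := oner_neq0 K; rewrite -(jacobian_xy k); apply.
Qed.

Lemma jacobian_log_coordinates x y : jacobian x y != 0 ->
  log_coordinates cst v (1 + v (jacobian x y) - v (jacobian u w)) x y.
Proof.
exact: (jac_log_coordinates pchar0 (ff_deriv_derivation k ord0)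
  (ff_deriv_derivation k ord_max) val_v jacobian_order).
Qed.

(** A matrix whose columns are linear forms [x], [y] and [z], with [z] of least
    order along the divisor, so that [x / z] and [y / z] are regular there. *)
Definition regular_frame (N : 'M[k]_3) : Prop :=
  N \in unitmx /\ v (linform N i2) = mco.

Lemma linform_neq0 N i : N \in unitmx -> linform N i != 0.
Proof.
move=> uN; have Jxy : jacobian (ff_x k) (ff_y k) != 0 by rewrite jacobian_xy oner_eq0.
pose L : {poly {poly k}} := ((N i2 i)%:P + (N i0 i)%:P * 'X)%:P + ((N i1 i)%:P)%:P * 'X.
have -> : linform N i = eval2 cst (ff_x k) (ff_y k) L.
  rewrite linformE /L /eval2 rmorphD rmorphM /= !evalpC evalpX /= /eval1.
  by rewrite rmorphD rmorphM /= !evalpC evalpX /= addrAC (addrC _ (ff_const (N i2 i))).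
apply: (log_coord_inj (jacobian_log_coordinates Jxy)).
apply/eqP => L0; have c0 : col i N = 0.
  have L00 : (N i2 i)%:P + (N i0 i)%:P * 'X = 0 :> {poly k}.
    by have := congr1 (fun q : {poly {poly k}} => q`_0) L0;
      rewrite coef0 coefD coefC coefMX /= addr0.
  have L1 : N i1 i = 0.
    have := congr1 (fun q : {poly {poly k}} => q`_1`_0) L0.
    by rewrite !coef0 coefD coefC coefMX /= add0r !coefC.
  have L2 : N i2 i = 0.
    by have := congr1 (fun q : {poly k} => q`_0) L00;
      rewrite coef0 coefD coefC coefMX /= addr0.
  have L3 : N i0 i = 0.
    by have := congr1 (fun q : {poly k} => q`_1) L00;
      rewrite coef0 coefD coefC coefMX /= add0r coefC.
  apply/colP => j; rewrite !mxE; case: j => -[|[|[|//]]] l.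
  - by rewrite -[RHS]L3; congr (N _ _); apply: val_inj.
  - by rewrite -[RHS]L1; congr (N _ _); apply: val_inj.
  - by rewrite -[RHS]L2; congr (N _ _); apply: val_inj.
have : delta_mx i 0 = 0 :> 'cV[k]_3 by rewrite -(mulKmx uN (delta_mx i 0)) -colE c0 mulmx0.
by move/matrixP/(_ i 0); rewrite !mxE !eqxx => /eqP; rewrite oner_eq0.
Qed.

Lemma min_coord_order_le j : mco <= v (homog_coord k j).
Proof.
rewrite /min_coord_order /homog_coord !ge_min.
by case: j => -[|[|[|//]]] l /=; rewrite ?(dval1 val_v) lexx ?orbT.
Qed.

Lemma linform_order_ge N i : N \in unitmx -> mco <= v (linform N i).
Proof.
move=> uN; apply: (vge_nz (linform_neq0 i uN)); apply: (vge_sum val_v) => j.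
rewrite -[mco]add0r; apply: (vgeM val_v); first exact: (vge_cst val_v).
by right; apply: min_coord_order_le.
Qed.

Lemma regular_frame_exists : exists N, regular_frame N.
Proof.
have [i vi] : exists i, v (homog_coord k i) = mco.
  rewrite /min_coord_order; case: (leP (v (ff_y k)) 0) => h; case: leP => h'.
  - by exists i0.
  - by exists i1.
  - by exists i0.
  - by exists i2; apply: (dval1 val_v).
exists (tperm_mx i i2); split; first exact: unitmx_perm.
rewrite /linform (bigD1 i) //= !mxE tpermL eqxx rmorph1 mul1r big1 ?addr0 // => j ji.
rewrite !mxE; case: eqP => [E|_]; last by rewrite rmorph0 mul0r.
by move/eqP: E; rewrite -{2}(tpermL i i2) (inj_eq perm_inj) (negPf ji).
Qed.

(* Without this, comparing two linear forms unfolds the function field. *)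
#[local] Opaque linform.

Definition frame_x N := linform N i0 / linform N i2.
Definition frame_y N := linform N i1 / linform N i2.

Lemma frame_log_coordinates N : regular_frame N ->
  log_coordinates cst v A (frame_x N) (frame_y N) /\
  log_coordinates cst v (A - v (frame_x N)) (frame_x N) (frame_y N / frame_x N).
Proof.
move=> [uN vN]; have L2 := linform_neq0 i2 uN; have L0 := linform_neq0 i0 uN.
have x0 : frame_x N != 0 := mulf_neq0 L0 (invr_neq0 L2).
have JE : jacobian (frame_x N) (frame_y N) = cst (\det N) / linform N i2 ^+ 3.
  exact: jacobian_linform.
have dN : \det N != 0 by rewrite -unitfE -unitmxE.
have cN : cst (\det N) != 0 by rewrite fmorph_eq0.
have L23 := expf_neq0 3 L2.
have J0 : jacobian (frame_x N) (frame_y N) != 0.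
  by rewrite JE; exact: mulf_neq0 cN (invr_neq0 L23).
have vJ : v (jacobian (frame_x N) (frame_y N)) = - (mco *+ 3).
  rewrite JE (dvalM val_v cN (invr_neq0 L23)) (dvalV val_v L23) (dvalX val_v 3 L2) vN.
  by rewrite (dval_const val_v dN) add0r.
have AE : A = 1 + v (jacobian (frame_x N) (frame_y N)) - v (jacobian u w).
  by rewrite vJ /log_discrepancy /discrepancy; lia.
split; first by rewrite AE; apply: jacobian_log_coordinates.
have J1 : jacobian (frame_x N) (frame_y N / frame_x N) =
    jacobian (frame_x N) (frame_y N) / frame_x N.
  exact: (jac_blowup (ff_deriv_derivation k ord0) (ff_deriv_derivation k ord_max) _ x0).
have J10 : jacobian (frame_x N) (frame_y N / frame_x N) != 0.
  by rewrite J1; exact: mulf_neq0 J0 (invr_neq0 x0).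
have := jacobian_log_coordinates J10.
rewrite {1}J1 (dvalM val_v J0 (invr_neq0 x0)) (dvalV val_v x0).
suff -> : A - v (frame_x N) = 1 + (v (jacobian (frame_x N) (frame_y N)) - v (frame_x N)) -
  v (jacobian u w) by [].
by rewrite AE addrAC addrA.
Qed.

(** The frames reached by affine substitutions are the competitors of an optimal
    frame. *)
Lemma frame_change N (p q r s a b : k) : regular_frame N -> p * s - q * r != 0 ->
  exists N', [/\ regular_frame N',
    frame_x N' = cst p * frame_x N + cst q * frame_y N + cst a &
    frame_y N' = cst r * frame_x N + cst s * frame_y N + cst b].
Proof.
move=> [uN vN] det0; have L2 := linform_neq0 i2 uN.
pose E : 'M[k]_3 := \matrix_(l, i)
  nth 0 (nth [::] [:: [:: p; r; 0]; [:: q; s; 0]; [:: a; b; 1]] l) i.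
have uE : E \in unitmx.
  rewrite unitmxE det_mx33 !mxE /= unitfE.
  by rewrite !mul0r !mulr1 !subr0 addr0 (mulrC r).
have M i : linform (N *m E) i =
    cst (E i0 i) * linform N i0 + cst (E i1 i) * linform N i1 + cst (E i2 i) * linform N i2.
  rewrite linform_mul !big_ord_recl big_ord0 addr0 addrA.
  by have -> : lift ord0 (lift ord0 ord0) = i2 by apply: val_inj.
have M2 : linform (N *m E) i2 = linform N i2.
  by rewrite M !mxE /= rmorph0 rmorph1 !mul0r !add0r mul1r.
have div (c e g x y : K) : (c * x + e * y + g * linform N i2) / linform N i2 =
    c * (x / linform N i2) + e * (y / linform N i2) + g.
  by rewrite !mulrDl mulfK // !mulrA.
exists (N *m E); split; first by split; rewrite ?unitmx_mul ?uN // M2.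
- by rewrite /frame_x M2 M !mxE /= div.
- by rewrite /frame_y M2 M !mxE /= div.
Qed.

Lemma frame_coord_neq0 N : regular_frame N -> frame_x N != 0 /\ frame_y N != 0.
Proof. by move=> /frame_log_coordinates [/log_coord_neq0]. Qed.

Lemma frame_order_ge0 N : regular_frame N -> 0 <= v (frame_x N) /\ 0 <= v (frame_y N).
Proof.
move=> [uN vN]; have L2 := linform_neq0 i2 uN.
rewrite /frame_x /frame_y.
rewrite (dvalM val_v (linform_neq0 i0 uN) (invr_neq0 L2)).
rewrite (dvalM val_v (linform_neq0 i1 uN) (invr_neq0 L2)) (dvalV val_v L2) vN !subr_ge0.
by rewrite !linform_order_ge.
Qed.

Lemma frame_order_sum N : regular_frame N -> v (frame_x N) + v (frame_y N) <= A.
Proof. by move=> /frame_log_coordinates [/(log_coord_sum val_v)]. Qed.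

Lemma log_discrepancy_ge0 : 0 <= A.
Proof.
have [N rN] := regular_frame_exists; have [x0 y0] := frame_order_ge0 rN.
by apply: le_trans (frame_order_sum rN); apply: addr_ge0.
Qed.

Lemma bounded_maximum (T : Type) (S : T -> Prop) (h : T -> int) (B : int) :
  (exists t, S t) -> (forall t, S t -> 0 <= h t <= B) ->
  exists t, S t /\ forall s, S s -> h s <= h t.
Proof.
move=> [t0 St0] hB.
pose good n := `[< exists t, S t /\ h t = n%:Z >].
have ex_good : exists n, good n.
  exists (absz (h t0)); apply/asboolP; exists t0; split=> //.
  by have /andP [h0 _] := hB _ St0; rewrite gez0_abs.
have bnd n : good n -> (n <= absz B)%N.
  by move=> /asboolP [t [St ht]]; have := hB _ St; rewrite ht; lia.
case: (ex_maxnP ex_good bnd) => n /asboolP [t [St ht]] max_n.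
exists t; split=> // s Ss; have /andP [h0 _] := hB _ Ss.
have /max_n : good (absz (h s)) by apply/asboolP; exists s; rewrite gez0_abs.
by rewrite ht; lia.
Qed.

(** Orders of coordinates are bounded by the log discrepancy, so that the order of
    [y] and then that of [x] can be maximised. *)
Lemma optimal_frame : exists N, [/\ regular_frame N,
  forall N', regular_frame N' -> v (frame_y N') <= v (frame_y N) &
  forall N', regular_frame N' -> v (frame_y N') = v (frame_y N) ->
    v (frame_x N') <= v (frame_x N)].
Proof.
have bnd N : regular_frame N -> 0 <= v (frame_x N) <= A /\ 0 <= v (frame_y N) <= A.
  move=> rN; have [x0 y0] := frame_order_ge0 rN; have := frame_order_sum rN.
  by move: (v _) (v _) x0 y0 => a b; lia.
have [N1 [r1 max1]] : exists N, regular_frame N /\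
    forall N', regular_frame N' -> v (frame_y N') <= v (frame_y N).
  apply: (@bounded_maximum _ _ (fun N => v (frame_y N)) A regular_frame_exists).
  by move=> N /bnd [].
have [N2 [[r2 y2] max2]] : exists N, (regular_frame N /\ v (frame_y N) = v (frame_y N1)) /\
    forall N', regular_frame N' /\ v (frame_y N') = v (frame_y N1) ->
    v (frame_x N') <= v (frame_x N).
  apply: (@bounded_maximum _ _ (fun N => v (frame_x N)) A).
    by exists N1.
  by move=> N [/bnd []].
exists N2; split=> // [N'|N' r' E]; first by rewrite y2; apply: max1.
by apply: max2; rewrite -y2.
Qed.

Lemma curve_order_chart d N (f : ternary_form k d) : regular_frame N -> f != 0 ->
  curve_order v f = v (eval2 cst (frame_x N) (frame_y N) (chart (form_act (invmx N) f))).
Proof.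
move=> rN f0; have [uN vN] := rN; have L2 := linform_neq0 i2 uN.
have [coord _] := frame_log_coordinates rN.
have f'0 : form_act (invmx N) f != 0 by rewrite form_act_eq0 ?unitmx_inv.
have E0 := log_coord_inj coord (chart_neq0 f'0).
rewrite /curve_order -{1}(form_act1 f) -(mulmxV uN) -form_actM dehomogenize_form_act.
have -> : linform N = (fun i : 'I_3 => [:: linform N i0; linform N i1; linform N i2]`_i).
  apply/funext => -[[|[|[|//]]] l] /=; congr (linform N _); exact: val_inj.
rewrite (eval_chart _ _ _ L2) (dvalM val_v (expf_neq0 d L2) E0) (dvalX val_v d L2) vN.
by rewrite -mulr_natl natz addrAC subrr add0r.
Qed.

(** In an optimal frame the orders [v x <= v y] locate the centre: a point with a
    distinguished tangent direction when [0 < v x < v y], a point without one when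
    [0 < v x = v y], the line [y = 0] when [0 = v x < v y], and a curve of higher
    degree when both vanish.  Optimality says that no other linear form has larger
    order, which is what the respective bounds require. *)
Theorem curve_order_bound d (f : ternary_form k d) : f != 0 ->
  exists2 N, N \in unitmx & forall m, m \in msupp (form_act N f) ->
    curve_order v f *+ 2 <= A *+ maxn d (2 * m i1).
Proof.
move=> f0; have [N [rN max_y max_x]] := optimal_frame; have [uN _] := rN.
exists (invmx N); first by rewrite unitmx_inv.
rewrite (curve_order_chart rN f0); set f' := form_act _ f.
have f'0 : f' != 0 by rewrite form_act_eq0 ?unitmx_inv.
set x := frame_x N; set y := frame_y N; pose F := chart f'.
have F0 : F != 0 by apply: chart_neq0.
have degF : total_degree_le d F by apply: chart_total_degree.
have [coord coord1] := frame_log_coordinates rN; rewrite -/x -/y in coord coord1 *.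
have [x0 y0] := frame_order_ge0 rN; rewrite -/x -/y in x0 y0.
have ex_r : exists j, F`_j != 0.
  by exists (size F).-1; rewrite -lead_coefE lead_coef_eq0.
case: (ex_minnP ex_r) => r Fr min_r.
have Fr0 j : (j < r)%N -> F`_j = 0.
  by move=> jr; apply/eqP; apply: contraTT jr => /min_r; rewrite -leqNgt.
move=> m /chart_coef Fm.
have rm : (r <= m i1)%N by apply: min_r; apply: contra_neq Fm => ->; rewrite coef0.
have A0 := log_discrepancy_ge0.
have widen B : v (eval2 cst x y F) *+ 2 <= A *+ B -> (B <= maxn d (2 * m i1))%N ->
    v (eval2 cst x y F) *+ 2 <= A *+ maxn d (2 * m i1).
  by move=> le_B /(ler_wpMn2l A0); apply: le_trans.
have le_r : (maxn d (2 * r) <= maxn d (2 * m i1))%N.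
  by rewrite geq_max leq_maxl leq_max leq_mul ?orbT.
have le_d : (d <= maxn d (2 * m i1))%N by apply: leq_maxl.
have vxy : v x <= v y.
  have [|N' [r' _ E]] := @frame_change N 0 1 1 0 0 0 rN.
    by rewrite mul0r mulr1 sub0r oppr_eq0 oner_eq0.
  have := max_y N' r'; rewrite E rmorph0 rmorph1 mul1r mul0r !addr0.
  by [].
have [vx|vx] := ltP 0 (v x).
  case: (ltP (v x) (v y)) => [lt|ge].
    exact: widen (dval_le_point val_v pchar0 coord coord1 vx lt degF Fr Fr0) le_r.
  have vE : v x = v y by apply/eqP; rewrite eq_le vxy.
  have [nx0 _] := frame_coord_neq0 rN.
  apply: widen (dval_le_ordinary val_v coord vE vx _ degF F0) le_d.
  apply: (transcendental_residue val_v) => c.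
  have [|N' [r' Ex Ey]] := @frame_change N 1 0 (- c) 1 0 0 rN.
    by rewrite mul1r mul0r subr0 oner_eq0.
  have zE : frame_y N' = y - cst c * x.
    by rewrite Ey rmorph0 addr0 rmorph1 mul1r rmorphN mulNr addrC.
  have [_ nz] := frame_coord_neq0 r'; rewrite zE in nz.
  have vz : v (y - cst c * x) = v x.
    apply/eqP; rewrite eq_le {1}vE -{1}zE max_y //=.
    apply: (vge_nz nz); apply: (vgeB val_v); first by right; rewrite vE.
    by rewrite -[v x]add0r; apply: (vgeM val_v); [apply: (vge_cst val_v)|apply: vge_refl].
  have -> : y / x - cst c = (y - cst c * x) / x by rewrite mulrBl (mulfK nx0).
  split; first exact: mulf_neq0 nz (invr_neq0 nx0).
  by rewrite (dvalM val_v nz (invr_neq0 nx0)) (dvalV val_v nx0) vz subrr.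
have {x0}vx0 : v x = 0 by apply/eqP; rewrite eq_le vx.
have [vy|vy] := ltP 0 (v y).
  have res_x : residue_transcendental cst v x; last first.
    exact: widen (dval_le_line val_v d coord res_x vy Fr Fr0) le_r.
  apply: (transcendental_residue val_v) => c.
  have [|N' [r' Ex Ey]] := @frame_change N 1 0 0 1 (- c) 0 rN.
    by rewrite mul1r mul0r subr0 oner_eq0.
  have xE : frame_x N' = x - cst c.
    by rewrite Ex rmorph0 rmorph1 mul1r mul0r addr0 rmorphN.
  have yE : frame_y N' = y by rewrite Ey rmorph0 rmorph1 mul1r mul0r add0r addr0.
  have [nx _] := frame_coord_neq0 r'; have [vx' _] := frame_order_ge0 r'.
  have := max_x N' r'; rewrite yE => /(_ erefl); rewrite -/x vx0 => le0.
  by rewrite -xE; split=> //; apply/eqP; rewrite eq_le le0.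
have {}vy : v y = 0 by apply/eqP; rewrite eq_le vy.
apply: widen (dval_le_curve val_v pchar0 coord _ degF F0) le_d => a b c abc.
have flat p q : p * c - q * b != 0 -> v (cst a + cst b * x + cst c * y) = 0.
  move=> det0; have [N' [r' _ Ey]] := @frame_change N p q b c 0 a rN det0.
  rewrite [cst a + _ + _]addrAC (addrAC (cst a)) -addrA addrC -Ey.
  have [_ vy'] := frame_order_ge0 r'; have := max_y N' r'; rewrite -/y vy => le0.
  by apply/eqP; rewrite eq_le le0.
case: (eqVneq c 0) abc => [c0|c0 _]; last by apply: (flat 1 0); rewrite mul1r mul0r subr0.
case: (eqVneq b 0) => [b0|b0 _].
  rewrite !orbF b0 c0 !rmorph0 !mul0r !addr0 => a0.
  exact: dval_const a0.
by apply: (flat 0 1); rewrite mul0r mul1r sub0r oppr_eq0.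
Qed.

End AdaptedCoordinates.

(** * The action on bivectors *)

Section TensorAction.
Variables (k : fieldType) (d : nat).
Implicit Types (A B : 'M[k]_3) (f g : ternary_form k d) (w : tensor2 k d).

Lemma form_act_mxM A B :
  form_act_mx d (A *m B) = form_act_mx d B *m form_act_mx d A :> tensor2 k d.
Proof.
apply/row_matrixP => i; rewrite !rowE mulmxA.
have /= E C (r : 'rV[k]_(dim (ternary_form k d))) :
    r *m form_act_mx d C = v2r (form_act C (r2v r : ternary_form k d)).
  by rewrite form_act_mxE r2vK.
by rewrite !E v2rK form_actM.
Qed.

Lemma form_act_mx1 : form_act_mx d 1%:M = 1%:M :> tensor2 k d.
Proof.
apply/row_matrixP => i; rewrite !rowE mulmx1.
rewrite -[delta_mx 0 i in LHS](r2vK (_ : 'rV_(dim (ternary_form k d)))).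
by rewrite -form_act_mxE form_act1 r2vK.
Qed.

Lemma tensor_actM A B w : tensor_act A (tensor_act B w) = tensor_act (A *m B) w.
Proof. by rewrite /tensor_act form_act_mxM trmx_mul !mulmxA. Qed.

Lemma tensor_act1 w : tensor_act 1%:M w = w.
Proof. by rewrite /tensor_act form_act_mx1 trmx1 mul1mx mulmx1. Qed.

Lemma tensor_actZ A c w : tensor_act A (c *: w) = c *: tensor_act A w.
Proof. by rewrite /tensor_act -scalemxAr -scalemxAl. Qed.

Lemma tensor_act_sum A (I : Type) (r : seq I) (P : pred I) (F : I -> tensor2 k d) :
  tensor_act A (\sum_(i <- r | P i) F i) = \sum_(i <- r | P i) tensor_act A (F i).
Proof. by rewrite /tensor_act mulmx_sumr mulmx_suml. Qed.

Lemma wedgeZl c f g : wedge (c *: f) g = c *: wedge f g.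
Proof.
have E : v2r (c *: f) = c *: v2r f by rewrite linearZ.
have ET : (c *: v2r f)^T = c *: (v2r f)^T by rewrite linearZ.
by rewrite /wedge E ET -scalemxAl -scalemxAr scalerBr.
Qed.

Lemma wedgeC f g : wedge f g = - wedge g f.
Proof. by rewrite /wedge opprB. Qed.

Lemma wedgeZr c f g : wedge f (c *: g) = c *: wedge f g.
Proof. by rewrite wedgeC wedgeZl wedgeC scalerN opprK. Qed.

Lemma wedgeDl f f' g : wedge (f + f') g = wedge f g + wedge f' g.
Proof.
have E : v2r (f + f') = v2r f + v2r f' by rewrite raddfD.
have ET : (v2r f + v2r f')^T = (v2r f)^T + (v2r f')^T by rewrite linearD.
by rewrite /wedge E ET mulmxDl mulmxDr opprD addrACA.
Qed.

Lemma wedge_self f : wedge f f = 0.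
Proof. by rewrite /wedge subrr. Qed.

Lemma wedge0l g : wedge 0 g = 0.
Proof. by rewrite -(scale0r g) wedgeZl scale0r. Qed.

Lemma wedge_suml (I : Type) (r : seq I) (F : I -> ternary_form k d) g :
  wedge (\sum_(i <- r) F i) g = \sum_(i <- r) wedge (F i) g.
Proof.
elim: r => [|i r IH]; first by rewrite !big_nil wedge0l.
by rewrite !big_cons wedgeDl IH.
Qed.

Lemma wedge_sumr (I : Type) (r : seq I) (F : I -> ternary_form k d) f :
  wedge f (\sum_(i <- r) F i) = \sum_(i <- r) wedge f (F i).
Proof.
by rewrite wedgeC wedge_suml -sumrN; apply: eq_bigr => i _; rewrite -wedgeC.
Qed.

(** A member of a pencil can be completed to a basis without changing the
    Plücker lift, up to a scalar. *)
Lemma plucker_lift_member (P : {vspace ternary_form k d}) w f :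
  plucker_lift P w -> f \in P -> f != 0 ->
  exists c g, c != 0 /\ w = c *: wedge f g.
Proof.
move=> [f1 [g1 [-> ->]]]; rewrite span_cons span_seq1 => /memv_addP.
move=> [_ /vlineP [a ->] [_ /vlineP [b ->] ->]] f0.
case: (eqVneq a 0) f0 => [->|a0 _].
  rewrite scale0r add0r => bg0; have b0 : b != 0.
    by apply: contra_neq bg0 => ->; rewrite scale0r.
  exists (- b^-1), f1; rewrite oppr_eq0 invr_eq0; split=> //.
  by rewrite wedgeZl scalerA mulNr mulVf // scaleN1r -wedgeC.
exists a^-1, g1; rewrite invr_eq0; split=> //.
by rewrite wedgeDl !wedgeZl wedge_self scaler0 addr0 scalerA mulVf // scale1r.
Qed.
End TensorAction.

(** * Limits of one-parameter subgroups *)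

Section Limits.
Variable k : fieldType.
Hypothesis pchar0 : [pchar k] =i pred0.

Lemma natr_inj_pchar0 : injective (fun n => n%:R : k).
Proof.
move=> m n /= E; wlog mn : m n E / (m <= n)%N.
  by move=> W; case: (leqP m n) => [/W->//|/ltnW /W->//].
have /eqP : (n - m)%:R = 0 :> k by rewrite natrB // E subrr.
by rewrite ((pcharf0P k).1 pchar0) subn_eq0 => nm; apply/eqP; rewrite eqn_leq mn.
Qed.

Lemma poly_eq0_nonzero (G : {poly k}) : (forall s, s != 0 -> G.[s] = 0) -> G = 0.
Proof.
move=> Gs; apply/eqP/negPn/negP => G0.
pose rs : seq k := [seq i.+1%:R | i <- iota 0 (size G)].
have : (size rs < size G)%N.
  apply: max_poly_roots => //.
    apply/allP => _ /mapP [i _ ->]; rewrite /root Gs //.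
    by rewrite ((pcharf0P k).1 pchar0).
  by rewrite map_inj_uniq ?iota_uniq // => i j /natr_inj_pchar0 [].
by rewrite size_map size_iota ltnn.
Qed.

(** Restricted to the curve, a polynomial that vanishes on [S] is a polynomial in
    [s] with infinitely many roots. *)
Lemma zariski_closure_limit m n (S : set 'M[k]_(m, n)) (B : nat -> 'M[k]_(m, n)) M :
  (forall s, s != 0 -> S (\sum_(e < M.+1) s ^+ e *: B e)) -> zariski_closure S (B 0%N).
Proof.
move=> SB F FS.
pose G : {poly k} := mmap (@polyC k) (fun i => \poly_(e < M.+1) mxvec (B e) ord0 i) F.
have GE s : G.[s] = F.@[mxvec (\sum_(e < M.+1) s ^+ e *: B e) ord0].
  rewrite -[LHS]/(horner_eval s G) /G /mmap rmorph_sum /= mevalE.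
  apply: eq_bigr => e _; rewrite rmorphM /= /horner_eval hornerC; congr (_ * _).
  rewrite /mmap1 -[LHS]/(horner_eval s _) rmorph_prod; apply: eq_bigr => i _ /=.
  rewrite rmorphXn /= /horner_eval; congr (_ ^+ _).
  rewrite horner_poly linear_sum summxE; apply: eq_bigr => l _.
  by rewrite linearZ /= mxE mulrC.
have G0 : G = 0 by apply: poly_eq0_nonzero => s s0; rewrite GE FS //; apply: SB.
have := GE 0; rewrite G0 horner0 big_ord_recl expr0 scale1r big1 ?addr0 // => e _.
by rewrite expr0n scale0r.
Qed.
End Limits.

(** * The one-parameter subgroup attached to a line *)

Section LineSubgroup.
Variables (k : fieldType) (d : nat).
Local Notation i0 := (ord0 : 'I_3).
Local Notation i1 := (lift ord0 ord0 : 'I_3).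
Local Notation i2 := (ord_max : 'I_3).
Implicit Types (f g : ternary_form k d).

(** The one-parameter subgroup that tests the multiplicity of the line [y = 0]. *)
Definition line_subgroup (s : k) : 'M[k]_3 :=
  diag_mx (\row_i if i == i1 then s ^+ 2 else s^-1).

Lemma line_subgroup_det s : s != 0 -> \det (line_subgroup s) = 1.
Proof.
move=> s0; rewrite det_diag !big_ord_recl big_ord0 !mxE /=.
by rewrite mulr1 expr2 mulrA mulrCA mulVf // mulr1 mulfV.
Qed.

Lemma component_homog j f :
  \sum_(m <- msupp f | m i1 == j) f@_m *: 'X_[m] \is d.-homog.
Proof.
rewrite big_seq_cond; apply: rpred_sum => m /andP [mf _]; apply: rpredZ.
by rewrite dhomogX; apply/eqP; move/dhomogP: (dhomog_is_dhomog f); apply.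
Qed.

Definition component j f : ternary_form k d := DHomog (component_homog j f).

Lemma mcoeff_component j f m :
  (component j f)@_m = if m i1 == j then f@_m else 0.
Proof.
rewrite /= raddf_sum /= big_mkcond /=.
under eq_bigr do rewrite mcoeffZ mcoeffX.
have [mf|mf] := boolP (m \in msupp f).
  rewrite (bigD1_seq m) ?msupp_uniq //= eqxx mulr1 big1 ?addr0 // => e em.
  by rewrite (negPf em) mulr0 if_same.
rewrite (memN_msupp_eq0 mf) if_same big1_seq // => e /andP [_ ef].
by case: (e =P m) => [E|_]; [rewrite -E ef in mf|rewrite mulr0 if_same].
Qed.

Lemma sum_component f : f = \sum_(j < d.+1) component j f.
Proof.
apply/val_inj/mpolyP => m.
have coefD : {morph (fun g : ternary_form k d => (g : {mpoly k[3]})@_m) : g h / g + h}.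
  by move=> g h; apply: mcoeffD.
have coef0 : ((0 : ternary_form k d) : {mpoly k[3]})@_m = 0 by apply: mcoeff0.
rewrite [RHS](big_morph _ coefD coef0).
under eq_bigr => j _ do rewrite mcoeff_component.
have [mf|mf] := boolP (m \in msupp f); last first.
  by rewrite (memN_msupp_eq0 mf) big1 // => j _; rewrite if_same.
have md : (m i1 < d.+1)%N.
  have <- : mdeg m = d by move/dhomogP: (dhomog_is_dhomog f); apply.
  by rewrite ltnS mdegE (bigD1 i1) //= leq_addr.
rewrite (bigD1 (Ordinal md)) //= eqxx big1 ?addr0 // => j.
by rewrite -val_eqE /= eq_sym => /negPf ->.
Qed.

Lemma component_eq0 j f : (forall m, m \in msupp f -> m i1 != j) -> component j f = 0.
Proof.
move=> fj; apply/val_inj/mpolyP => m; rewrite mcoeff_component mcoeff0.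
case: eqP => // E; apply: memN_msupp_eq0; apply/negP => /fj.
by rewrite E eqxx.
Qed.

Lemma line_subgroup_component s j f : s != 0 ->
  form_act (line_subgroup s) (component j f) =
  (s^-1 ^+ d * s ^+ (3 * j)) *: component j f.
Proof.
move=> s0; apply: val_inj.
rewrite -[LHS]/(mpoly_of_dhomog (component j f) \mPo linear_subst (line_subgroup s)).
rewrite -[RHS]/((s^-1 ^+ d * s ^+ (3 * j)) *: mpoly_of_dhomog (component j f)).
rewrite comp_mpolyEX [in RHS](mpolyE (component j f)) scaler_sumr big_seq [RHS]big_seq.
apply: eq_bigr => m mf; rewrite scalerA mulrC -scalerA; congr (_ *: _).
have mj : m i1 = j.
  by move: mf; rewrite mcoeff_msupp mcoeff_component; case: (m i1 =P j) => // _ /eqP [].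
have md : mdeg m = d by move/dhomogP: (dhomog_is_dhomog (component j f)); apply.
rewrite comp_mpolyX.
have E i : tnth (linear_subst (line_subgroup s)) i =
    (if i == i1 then s ^+ 2 else s^-1) *: 'X_i.
  rewrite tnth_mktuple (bigD1 i) //= !mxE eqxx mulr1n big1 ?addr0 // => l li.
  by rewrite !mxE (negPf li) mulr0n scale0r.
under eq_bigr do rewrite E exprZn.
rewrite scaler_prod -mpolyXE_id; congr (_ *: _).
rewrite !big_ord_recl big_ord0 mulr1 /= -md mdegE !big_ord_recl big_ord0 addn0.
have key : s^-1 ^+ j * s ^+ (3 * j) = (s ^+ 2) ^+ j.
  have -> : (3 * j = j + 2 * j)%N by rewrite -mulSn.
  by rewrite exprD mulrA -exprMn mulVf // expr1n mul1r exprM.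
rewrite mj -key; move: (s ^+ (3 * j)) => c; rewrite !exprD.
move: (s^-1 ^+ m ord0) (s^-1 ^+ j) (s^-1 ^+ m _) => a b e.
by ring.
Qed.
End LineSubgroup.

Section LineLimit.
Variables (k : closedFieldType) (d : nat).
Hypothesis pchar0 : [pchar k] =i pred0.
Local Notation i1 := (lift ord0 ord0 : 'I_3).
Implicit Types (f g : ternary_form k d) (w : tensor2 k d).

(** The part of [wedge f g] on which [line_subgroup s] acts as [s ^ e]. *)
Definition wedge_weight f g (e : nat) : tensor2 k d :=
  \sum_(j < d.+1) \sum_(l < d.+1 | (3 * j + 3 * l == 2 * d + e)%N)
    wedge (component j f) (component l g).

Lemma wedge_line_subgroup s f g j l : s != 0 ->
  wedge (form_act (line_subgroup s) (component j f))
        (form_act (line_subgroup s) (component l g)) =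
  (s^-1 ^+ (2 * d) * s ^+ (3 * j + 3 * l)) *: wedge (component j f) (component l g).
Proof.
move=> s0; rewrite !line_subgroup_component // wedgeZl wedgeZr scalerA; congr (_ *: _).
move: (3 * j)%N (3 * l)%N => a b; rewrite mulSn mul1n !exprD.
by move: (s^-1 ^+ d) (s ^+ a) (s ^+ b) => x y z; ring.
Qed.

Lemma form_act_sum A (I : Type) (r : seq I) (F : I -> ternary_form k d) :
  form_act A (\sum_(i <- r) F i) = \sum_(i <- r) form_act A (F i).
Proof.
elim: r => [|i r IH]; first by rewrite !big_nil; apply: val_inj; rewrite /= raddf0.
by rewrite !big_cons -IH -[F i]scale1r form_act_linear !scale1r.
Qed.

Lemma line_subgroup_wedge s f g : s != 0 ->
  (forall m, m \in msupp f -> (2 * d <= 3 * m i1)%N) ->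
  tensor_act (line_subgroup s) (wedge f g) =
  \sum_(e < (4 * d).+1) s ^+ e *: wedge_weight f g e.
Proof.
move=> s0 fd; rewrite tensor_act_wedge {1}(sum_component f) {1}(sum_component g).
rewrite !form_act_sum wedge_suml.
under [RHS]eq_bigr do rewrite scaler_sumr.
rewrite exchange_big; apply: eq_bigr => j _; rewrite wedge_sumr.
under [RHS]eq_bigr do rewrite scaler_sumr big_mkcond.
rewrite exchange_big; apply: eq_bigr => l _; rewrite wedge_line_subgroup //.
have [jd|dj] := ltnP (3 * j) (2 * d).
  have -> : component j f = 0.
    by apply: component_eq0 => m /fd; apply: contraTneq => ->; rewrite -ltnNge.
  by rewrite wedge0l scaler0 big1 // => e _; rewrite scaler0 if_same.
have lt : (3 * j + 3 * l - 2 * d < (4 * d).+1)%N.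
  by have := ltn_ord j; have := ltn_ord l; lia.
rewrite -big_mkcond (big_pred1 (Ordinal lt)) /=; last first.
  by move=> e /=; rewrite -(inj_eq val_inj) /=; apply/eqP/eqP; lia.
congr (_ *: _); have -> : (3 * j + 3 * l = 2 * d + (3 * j + 3 * l - 2 * d))%N by lia.
by rewrite addKn exprD mulrA -exprMn mulVf // expr1n mul1r.
Qed.

Lemma wedge_weight0_fixed s f g : s != 0 ->
  tensor_act (line_subgroup s) (wedge_weight f g 0) = wedge_weight f g 0.
Proof.
move=> s0; rewrite tensor_act_sum; apply: eq_bigr => j _.
rewrite tensor_act_sum; apply: eq_bigr => l /eqP E.
rewrite tensor_act_wedge wedge_line_subgroup // E addn0.
by rewrite -exprMn mulVf // expr1n scale1r.
Qed.

(** A cube root of the determinant exists over an algebraically closed field. *)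
Lemma special_multiple (N : 'M[k]_3) : N \in unitmx ->
  exists2 c, c != 0 & \det (c *: N) = 1.
Proof.
move=> uN; have dN : \det N != 0 by rewrite -unitfE -unitmxE.
have /closed_rootP [c] : size ('X^3 - ((\det N)^-1)%:P) != 1%N.
  by rewrite size_XnsubC.
rewrite /root !hornerE subr_eq0 => /eqP cE; exists c.
  apply: contra_neq dN => c0; move: cE; rewrite c0 expr0n /= => /esym/eqP.
  by rewrite invr_eq0 => /eqP.
by rewrite detZ cE mulVf.
Qed.

(** In coordinates where a line is [y = 0], a member that contains the line [r]
    times has weights at least [3 r - d], and any other member has weights at
    least [- d].  For [3 r >= 2 d] no weight of the lift is negative, so that its
    part of weight 0 is the limit [w0]. *)
Lemma line_limit (P : {vspace ternary_form k d}) w f (N : 'M[k]_3) :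
  plucker_lift P w -> f \in P -> f != 0 -> N \in unitmx ->
  (forall m, m \in msupp (form_act N f) -> (2 * d <= 3 * m i1)%N) ->
  exists w0, [/\ zariski_closure (SL3_orbit w) w0,
    forall s, s != 0 -> tensor_act (line_subgroup s) w0 = w0 &
    (forall m, m \in msupp (form_act N f) -> (2 * d < 3 * m i1)%N) -> w0 = 0].
Proof.
move=> lift fP f0 uN fd; have [c [g [c0 wE]]] := plucker_lift_member lift fP f0.
have [a a0 detN] := special_multiple uN.
set f' := form_act (a *: N) f; set g' := form_act (a *: N) g.
have suppE m : m \in msupp f' -> m \in msupp (form_act N f).
  rewrite /f' form_act_scale !mcoeff_msupp mcoeffZ.
  by apply: contra_neq => ->; rewrite mulr0.
exists (c *: wedge_weight f' g' 0); split.
- apply: (@zariski_closure_limit _ pchar0 _ _ _ (fun e => c *: wedge_weight f' g' e) (4 * d)).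
  move=> s s0; exists (line_subgroup s *m (a *: N)).
    by rewrite /SL3 /= det_mulmx line_subgroup_det // detN mulr1.
  have f'd m : m \in msupp f' -> (2 * d <= 3 * m i1)%N by move=> /suppE; apply: fd.
  rewrite wE tensor_actZ -tensor_actM tensor_act_wedge (line_subgroup_wedge _ s0 f'd).
  by rewrite scaler_sumr; apply: eq_bigr => e _; rewrite !scalerA mulrC.
- by move=> s s0; rewrite tensor_actZ wedge_weight0_fixed.
- move=> strict; rewrite /wedge_weight big1 ?scaler0 // => j _; rewrite big1 // => l /eqP E.
  suff -> : component j f' = 0 by rewrite wedge0l.
  apply: component_eq0 => m /suppE /strict; apply: contraTneq => ->.
  by rewrite -leqNgt -[(2 * d)%N]addn0 -E leq_addr.
Qed.

(** A line of larger multiplicity would make 0 a limit of the lift. *)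
Lemma semistable_line (P : {vspace ternary_form k d}) f (N : 'M[k]_3) :
  semistable P -> f \in P -> f != 0 -> N \in unitmx ->
  exists2 m, m \in msupp (form_act N f) & (3 * m i1 <= 2 * d)%N.
Proof.
move=> [w [lift not0]] fP f0 uN; apply: contrapT => no_m; apply: not0.
have strict m : m \in msupp (form_act N f) -> (2 * d < 3 * m i1)%N.
  by move=> mf; rewrite ltnNge; apply/negP => le_m; apply: no_m; exists m.
have [w0 [cl _ /(_ strict) <-]] := line_limit lift fP f0 uN (fun m mf => ltnW (strict m mf)).
exact: cl.
Qed.

(** The limit would lie in the orbit of the lift; since the whole subgroup fixes
    the limit, the stabilizer of the lift would be infinite. *)
Lemma stable_line (P : {vspace ternary_form k d}) f (N : 'M[k]_3) :
  stable P -> f \in P -> f != 0 -> N \in unitmx ->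
  exists2 m, m \in msupp (form_act N f) & (3 * m i1 < 2 * d)%N.
Proof.
move=> [w [lift closed fin]] fP f0 uN; apply: contrapT => no_m.
have large m : m \in msupp (form_act N f) -> (2 * d <= 3 * m i1)%N.
  by move=> mf; rewrite leqNgt; apply/negP => lt_m; apply: no_m; exists m.
have [w0 [/closed [Q detQ wQ] fixed _]] := line_limit lift fP f0 uN large.
have uQ : Q \in unitmx by rewrite unitmxE detQ unitr1.
pose h (n : nat) := invmx Q *m line_subgroup (n.+1%:R) *m Q.
have n0 n : n.+1%:R != 0 :> k by rewrite ((pcharf0P k).1 pchar0).
have stab n : SL3_stabilizer w (h n).
  split; first by rewrite /SL3 /= !det_mulmx det_inv line_subgroup_det // detQ invr1 !mulr1.
  rewrite /h -!tensor_actM wQ fixed // -wQ tensor_actM mulVmx //; exact: tensor_act1.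
have inj_h : injective h.
  move=> m n /(congr1 (fun M => Q *m M *m invmx Q)); rewrite /h !mulmxA !mulmxV // !mul1mx.
  rewrite -!mulmxA !mulmxV // !mulmx1 => /matrixP/(_ ord0 ord0); rewrite !mxE eqxx /=.
  by rewrite !mulr1n => /invr_inj /(natr_inj_pchar0 pchar0) [].
apply: infinite_nat; rewrite (_ : [set: nat]%classic = (h @^-1` SL3_stabilizer w)%classic).
  by apply: finite_preimage fin; apply: in2W.
by apply/seteqP; split=> // n _; apply: stab.
Qed.
End LineLimit.

(** * Log canonical thresholds *)

Section Threshold.
Variables (R : realType) (d : nat).
Local Notation i1 := (lift ord0 ord0 : 'I_3).

Lemma complex_pchar0 : [pchar R[i]] =i pred0.
Proof. exact: pchar_num. Qed.

(** The pair with coefficient [t] is log canonical on the whole plane, so that the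
    constant 1 serves as the equation [h] that is nonzero at [p]. *)
Lemma lct_ge (f : ternary_form R[i] d) (p : 'rV[R[i]]_3) (t : R) : f != 0 -> 0 <= t ->
  (forall N : 'M[R[i]]_3, N \in unitmx ->
    exists2 m, m \in msupp (form_act N f) & t * (maxn d (2 * m i1))%:R <= 2) ->
  (t%:E <= lct p f)%E.
Proof.
move=> f0 t0 ft; apply: ereal_sup_ubound; exists t => //.
exists 0%N, (DHomog (dhomog1 _ _)); split; first by rewrite /= meval1 oner_eq0.
move=> v div_v _ u w uw.
have [N uN bound] := curve_order_bound complex_pchar0 div_v uw f0.
have [m mf tm] := ft N uN.
have A0 := log_discrepancy_ge0 complex_pchar0 div_v uw.
have := bound m mf; rewrite /log_discrepancy in A0 *.
move: (maxn _ _) tm (discrepancy v u w) (curve_order v f) A0 => B tB a c A0.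
rewrite -(ler_int R) !rmorphMn /= !rmorphD /= => le_c.
have A0' : 0 <= 1 + a%:~R :> R by rewrite -(ler_int R) rmorphD in A0.
rewrite -mulr_natr in le_c; rewrite -[X in _ <= X]mulr_natr in le_c.
have : 0 <= t * ((1 + a%:~R) * B%:R - c%:~R * 2) by rewrite mulr_ge0 // subr_ge0.
have : 0 <= (1 + a%:~R) * (2 - t * B%:R) :> R by rewrite mulr_ge0 // subr_ge0.
by move: (t * B%:R) => x; nra.
Qed.
End Threshold.

(** When every line has multiplicity less than [2 d / 3], integrality yields the
    larger coefficient on the right for all divisors at once. *)
Lemma threshold_gap (R : realFieldType) (x : R) : 1 <= x ->
  0 < 4 * x - 1 /\ 3 / (2 * x) < 6 / (4 * x - 1).
Proof.
move=> x1; have d0 : 0 < 4 * x - 1 by lra.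
have x2 : 0 < 2 * x by lra.
split=> //; rewrite ltr_pdivrMr // mulrAC ltr_pdivlMr //; lra.
Qed.

Theorem theorem1p2 (R : realType) (d : nat) (d_ge1 : (1 <= d)%N)
    (P : {vspace dhomog 3 R[i] d}) (pencilP : is_pencil P) :
  (semistable P ->
     forall f : dhomog 3 R[i] d, f \in P -> f != 0 ->
     forall p : 'rV[R[i]]_3, base_point P p ->
       ((3%:R / (2%:R * d%:R))%:E <= lct p f)%E) /\
  (stable P ->
     forall f : dhomog 3 R[i] d, f \in P -> f != 0 ->
     forall p : 'rV[R[i]]_3, base_point P p ->
       ((3%:R / (2%:R * d%:R))%:E < lct p f)%E).
Proof.
have d0 : 0 < d%:R :> R by rewrite ltr0n.
split=> [ss|st] f fP f0 p _.
  have t0 : 0 <= 3 / (2 * d%:R) :> R by rewrite divr_ge0 // mulr_ge0 // ltW.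
  apply: (lct_ge p f0 t0) => N uN.
  have [m mf lt_m] := semistable_line (@complex_pchar0 R) ss fP f0 uN.
  exists m => //; rewrite mulrAC ler_pdivrMr ?mulr_gt0 // -!natrM ler_nat.
  by move: lt_m; rewrite /maxn; case: ifP => _; lia.
have [d1 gap] : 0 < 4 * d%:R - 1 :> R /\ 3 / (2 * d%:R) < 6 / (4 * d%:R - 1) :> R.
  by apply: threshold_gap; rewrite ler1n.
apply: (@lt_le_trans _ _ (6 / (4 * d%:R - 1))%:E); first by rewrite lte_fin.
have t0 : 0 <= 6 / (4 * d%:R - 1) :> R by rewrite divr_ge0 // ltW.
apply: (lct_ge p f0 t0) => N uN; have [m mf lt_m] := stable_line (@complex_pchar0 R) st fP f0 uN.
(* An even number [6 m] below [4 d] is at most [4 d - 2], and [3 d <= 4 d - 1]. *)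
exists m => //; rewrite mulrAC ler_pdivrMr // mulrBr mulr1 lerBrDr -!natrM -natrD ler_nat.
by move: lt_m; rewrite /maxn; case: ifP => _; lia.
Qed.
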